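(* Let $G$ be a group acting properly, with uniformly bounded stabilizers, and cellularly on a CAT(0) cube complex of finite dimension. Then $G$ has property RD.
   Context: A length function on a group $G$ is a map $\ell:G\to\mathbb{R}_+$ with $\ell(e)=0$, $\ell(\gamma)=\ell(\gamma^{-1})$ and $\ell(\gamma\mu)\le \ell(\gamma)+\ell(\mu)$ for all $\gamma,\mu\in G$. For $f\in\mathbb{C}G$ (finitely supported functions $G\to\mathbb{C}$) let $\|f\|_2$ be the $\ell^2$-norm and $\|f\|_*=\sup\{\|f*g\|_2 : \|g\|_2=1\}$ the operator norm of $f$ acting by left convolution on $\ell^2(G)$. The group $G$ has property RD with respect to $\ell$ if there is a polynomial $P$ such that $\|f\|_*\le P(r)\|f\|_2$ for every $r\ge 0$ and every $f\in\mathbb{C}G$ supported in $\{\gamma:\ell(\gamma)\le r\}$. Here ''$G$ has property RD'' means with respect to some length function; when $G$ is finitely generated this is equivalent to property RD with respect to the word length. A cube complex is a metric polyhedral complex in which each cell is isometric to a Euclidean cube $[-1/2,1/2]^n$ and the gluing maps are isometries. It is CAT(0) if the metric induced by the Euclidean metrics on the cubes is CAT(0), and finite dimensional if there is $n<\infty$ such that it has no cells of dimension greater than $n$. ''Uniformly bounded stabilizers'' means that there is a constant $c$ such that every vertex stabilizer has at most $c$ elements. Acting cellularly means by isometries mapping cells to cells. *)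

(* Defs.v *)
From HB Require Import structures.
From mathcomp Require Import all_boot all_order all_algebra.
From mathcomp Require Import complex.
From mathcomp Require Import all_classical all_reals all_analysis.
Import Order.TTheory GRing.Theory Num.Theory.
Import numFieldNormedType.Exports.
Set Implicit Arguments.
Unset Strict Implicit.
Unset Printing Implicit Defensive.
Local Open Scope classical_set_scope.
Local Open Scope card_scope.
Local Open Scope ring_scope.

Section RapidDecay.
Variables (R : realType) (G : groupType).
Implicit Types (f g : G -> R[i]) (l : G -> R).

Definition length_function l :=
  [/\ forall x, 0 <= l x,
      l 1%g = 0,
      forall x, l (x^-1)%g = l x
    & forall x y, l (x * y)%g <= l x + l y].

(* [G] may be uncountable: [\esum] is the supremum of the finite partial sums.
   The value is [+oo] when [f] is not square summable. *)
Definition l2norm f : \bar R :=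
  sqrte (\esum_(x in [set: G]) (ComplexField.Normc.normc (f x) ^+ 2)%:E).

Definition finitely_supported f := finite_set [set x | f x != 0].

(* For finitely supported [f] the sum has finitely many nonzero terms; a sum
   over [\in] with infinite support is 0 by convention, which is never used. *)
Definition convolution f g : G -> R[i] :=
  fun x => \sum_(y \in [set: G]) f y * g (y^-1 * x)%g.

Definition opnorm f : \bar R :=
  ereal_sup [set l2norm (convolution f g) | g in [set g | l2norm g = 1%E]].

Definition property_RD_wrt l :=
  exists P : {poly R}, forall (r : R) f,
    0 <= r -> finitely_supported f -> (forall x, f x != 0 -> l x <= r) ->
    (opnorm f <= P.[r]%:E * l2norm f)%E.

Definition property_RD := exists l, length_function l /\ property_RD_wrt l.

End RapidDecay.

(* The library norm on ['rV[R]_n] is the sup norm, hence this definition. *)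
Definition euclidean_dist (R : realType) n (x y : 'rV[R]_n) : R :=
  Num.sqrt (\sum_i (x 0 i - y 0 i) ^+ 2).

Section CAT0.
Variables (R : realType) (X : metricType R).

Definition geodesic (p q : X) (c : R -> X) :=
  [/\ c 0 = p, c (mdist p q) = q &
      forall s t, 0 <= s <= mdist p q -> 0 <= t <= mdist p q ->
        mdist (c s) (c t) = `|s - t|].

Definition geodesic_space := forall p q : X, exists c, geodesic p q c.

(* [side i] runs from [v i] to [v (ordS i)], indices being cyclic mod 3. *)
Definition geodesic_triangle (v : 'I_3 -> X) (side : 'I_3 -> R -> X) :=
  forall i, geodesic (v i) (v (ordS i)) (side i).

Definition comparison_triangle (v : 'I_3 -> X) (w : 'I_3 -> 'rV[R]_2) :=
  forall i j, euclidean_dist (w i) (w j) = mdist (v i) (v j).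

(* [z] is the point of the segment [a, b] of the plane at distance [s]
   from [a]. *)
Definition comparison_point (a b : 'rV[R]_2) (s : R) (z : 'rV[R]_2) :=
  euclidean_dist a z = s /\
  exists t : R, 0 <= t <= 1 /\ z = (1 - t) *: a + t *: b.

Definition CAT0_inequality (v : 'I_3 -> X) (side : 'I_3 -> R -> X)
    (w : 'I_3 -> 'rV[R]_2) :=
  forall (i j : 'I_3) (s t : R) (y z : 'rV[R]_2),
    0 <= s <= mdist (v i) (v (ordS i)) ->
    0 <= t <= mdist (v j) (v (ordS j)) ->
    comparison_point (w i) (w (ordS i)) s y ->
    comparison_point (w j) (w (ordS j)) t z ->
    mdist (side i s) (side j t) <= euclidean_dist y z.

Definition CAT0 :=
  geodesic_space /\
  forall v side w, geodesic_triangle v side -> comparison_triangle v w ->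
    CAT0_inequality v side w.

End CAT0.

Section Cube.
Variables (R : realType) (n : nat).

Definition cube : set 'rV[R]_n := [set x | forall i, `|x 0 i| <= 2^-1].

(* The smallest closed face of the cube containing [x], i.e. the one having [x]
   in its relative interior. Every nonempty closed face is of this form. *)
Definition cube_supp (x : 'rV[R]_n) : set 'rV[R]_n :=
  [set y | cube y /\ forall i, `|x 0 i| = 2^-1 -> y 0 i = x 0 i].

Definition corner (x : 'rV[R]_n) := forall i, `|x 0 i| = 2^-1.

End Cube.

(* Metric polyhedral complexes in the sense of Bridson-Haefliger (I.7.37), all
   cells being unit cubes: [X] is the quotient of the disjoint union of the
   cubes [cube (dim c)], and [chart c] is the projection restricted to the cube
   of index [c] (its values outside [cube] are irrelevant). [chart_inj] says
   that charts are injective on the relative interior of each face, two points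
   being interior to the same face when they have the same [cube_supp]. *)
Record cube_complex (R : realType) (X : Type) := CubeComplex {
  cube_index : Type;
  dim : cube_index -> nat;
  chart : forall c : cube_index, 'rV[R]_(dim c) -> X;
  chart_surj : forall p : X, exists c x, cube x /\ @chart c x = p;
  chart_inj : forall c (x y : 'rV[R]_(dim c)), cube x -> cube y ->
    cube_supp x = cube_supp y -> chart x = chart y -> x = y;
  chart_glue : forall c c' (x : 'rV[R]_(dim c)) (x' : 'rV[R]_(dim c')),
    cube x -> cube x' -> chart x = chart x' ->
    exists h : 'rV[R]_(dim c) -> 'rV[R]_(dim c'),
      [/\ h @` cube_supp x = cube_supp x',
          forall y z, cube_supp x y -> cube_supp x z ->
            euclidean_dist (h y) (h z) = euclidean_dist y z
        & forall y, cube_supp x y -> chart y = chart (h y)]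
}.

Arguments dim {R X} _ _.
Arguments chart {R X _ c} _.

Section CubeComplexTheory.
Variables (R : realType) (X : Type) (K : cube_complex R X).

Definition is_cell (S : set X) :=
  exists (c : cube_index K) (x : 'rV[R]_(dim K c)),
    cube x /\ S = chart @` cube_supp x.

Definition is_vertex (p : X) :=
  exists c (x : 'rV[R]_(dim K c)), corner x /\ chart x = p.

Definition finite_dimensional := exists n, forall c, (dim K c <= n)%N.

(* Chains of points from [p] to [q], two consecutive ones lying in a common
   cube, of total length [l]. *)
Inductive cube_string : X -> X -> R -> Prop :=
| cube_string_nil p : cube_string p p 0
| cube_string_cons p q c (a b : 'rV[R]_(dim K c)) l :
    cube a -> cube b -> chart a = p -> cube_string (chart b) q l ->
    cube_string p q (euclidean_dist a b + l).

Definition induced_dist (p q : X) : \bar R :=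
  ereal_inf [set l%:E | l in cube_string p q].

End CubeComplexTheory.

Definition CAT0_cube_complex (R : realType) (X : metricType R)
    (K : cube_complex R X) :=
  [/\ [set: X] !=set0,
      forall p q : X, induced_dist K p q = (mdist p q)%:E
    & CAT0 X].

Section Actions.
Variables (R : realType) (G : groupType) (X : metricType R).
Variables (K : cube_complex R X) (act : G -> X -> X).

Definition is_action :=
  (forall p, act 1%g p = p) /\
  (forall g h p, act (g * h)%g p = act g (act h p)).

Definition cellular_action :=
  (forall g p q, mdist (act g p) (act g q) = mdist p q) /\
  (forall g S, is_cell K S -> is_cell K (act g @` S)).

Definition proper_action :=
  forall p : X, exists2 r : R, 0 < r &
    finite_set [set g | (act g @` ball p r) `&` ball p r !=set0].

Definition uniformly_bounded_stabilizers :=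
  exists N : nat, forall p, is_vertex K p -> [set g | act g p = p] #<= `I_N.

End Actions.

(* Main.v *)
(* A geodesic of a CAT(0) cube complex that leaves an interior point of an edge
   [u, v] perpendicularly stays inside the slices parallel to that edge, so it
   cannot end at a vertex. Hence a vertex p is never equidistant from u and v,
   and the sets {p | d(p, u) < d(p, v)} are the halfspaces of the hyperplane dual
   to the edge, obtained from the metric alone. An edge crosses a single
   hyperplane, and the edges at a vertex whose hyperplanes separate it from a
   given vertex lie in one cube. It follows that three vertices x, y, z have a
   median, a vertex lying in every halfspace that contains two of them, that at
   most n = dim X pairwise incomparable halfspaces separate two vertices, and so
   that the number of vertices between x and y at distance at most rho from x
   is polynomial in rho.

   For f supported in the ball of radius r of the length function
   g |-> d(x0, g x0), split the sum (f * g)(k) = sum_h f(h) g(h^-1 k) according to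
   the median m of x0, h x0, k x0, which is close to x0 and to h x0. There are
   polynomially many choices of m given h, given h^-1 k, and given k, and
   stabilizers are bounded; the Cauchy-Schwarz inequality, applied to the sum
   over m and to each of the inner sums, gives a polynomial bound for the
   operator norm of f. *)
Require Import Defs.
From mathcomp Require Import all_boot all_order all_algebra.
From mathcomp Require Import complex finmap ring lra zify.
From mathcomp Require Import all_classical all_reals all_analysis.
(* [vector.dim] would otherwise shadow the [dim] of [Defs]. *)
Import Defs.
Import Order.TTheory GRing.Theory Num.Theory.
Import numFieldNormedType.Exports.
Set Implicit Arguments.
Unset Strict Implicit.
Unset Printing Implicit Defensive.
Local Open Scope classical_set_scope.
Local Open Scope card_scope.
Local Open Scope ring_scope.

Local Notation ed := euclidean_dist.

(** * The Cauchy-Schwarz inequality for finite sums *)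

Section FiniteSums.
Variable R : realFieldType.

Lemma sum_cauchy_schwarz (I : Type) (s : seq I) (P : pred I) (a b : I -> R) :
  (\sum_(i <- s | P i) a i * b i) ^+ 2 <=
  (\sum_(i <- s | P i) a i ^+ 2) * (\sum_(i <- s | P i) b i ^+ 2).
Proof.
set A := \sum_(i <- s | P i) a i ^+ 2; set B := \sum_(i <- s | P i) b i ^+ 2.
set C := \sum_(i <- s | P i) a i * b i.
have [A0 B0] : 0 <= A /\ 0 <= B by split; apply: sumr_ge0 => i _; exact: sqr_ge0.
have quad x y : 0 <= x ^+ 2 * A + (x * y *+ 2) * C + y ^+ 2 * B.
  rewrite /A /B /C !mulr_sumr -!big_split /=.
  apply: sumr_ge0 => i _.
  by rewrite (_ : _ + _ = (x * a i + y * b i) ^+ 2) ?sqr_ge0 //; ring.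
(* The form is evaluated at [(B, - C)] when [B] is nonzero, and at [(- C, A + 1)] when [B = 0],
   where it forces [C = 0]. *)
have [B1|B1] := eqVneq B 0; last first.
  have {}B0 : 0 < B by rewrite lt_def B1.
  rewrite -subr_ge0 -(pmulr_rge0 _ B0).
  have := quad B (- C); rewrite (_ : _ + _ = B * (A * B - C ^+ 2)) //; ring.
have := quad (- C) (A + 1).
have -> : (- C) ^+ 2 * A + (- C * (A + 1) *+ 2) * C + (A + 1) ^+ 2 * B =
  (A + 1) ^+ 2 * B - C ^+ 2 * (A + 2) by ring.
by rewrite B1 !mulr0 sub0r oppr_ge0 pmulr_lle0 // ltr_wpDl.
Qed.

End FiniteSums.

Lemma norm_sqr1 (R : realDomainType) (e : R) : e ^+ 2 = 1 -> `|e| = 1.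
Proof.
by move=> e1; apply/eqP; rewrite -(eqrXn2 (n := 2)) // real_normK ?num_real // e1 expr1n.
Qed.

(** * Cubes and their gluing maps *)

Section Euclid.
Variables (R : realType) (n : nat).
Implicit Types x y z p : 'rV[R]_n.

Lemma ed_sqr x y : ed x y ^+ 2 = \sum_i (x 0 i - y 0 i) ^+ 2.
Proof. by rewrite sqr_sqrtr // sumr_ge0 // => i _; exact: sqr_ge0. Qed.

Lemma ed_ge0 x y : 0 <= ed x y.
Proof. exact: sqrtr_ge0. Qed.

Lemma edC x y : ed x y = ed y x.
Proof. by rewrite /ed; under eq_bigr do rewrite -sqrrN opprB. Qed.

Lemma ed_le x y r : 0 <= r -> \sum_i (x 0 i - y 0 i) ^+ 2 <= r ^+ 2 -> ed x y <= r.
Proof. by move=> r0; rewrite -ed_sqr ler_pXn2r // nnegrE ed_ge0. Qed.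

Lemma ed_eq0 x y : ed x y = 0 -> x = y.
Proof.
move=> xy; have : \sum_i (x 0 i - y 0 i) ^+ 2 = 0 by rewrite -ed_sqr xy expr0n.
move/psumr_eq0P => xy0; apply/rowP => i.
by apply/eqP; rewrite -subr_eq0 -sqrf_eq0 xy0 // => j _; exact: sqr_ge0.
Qed.

Lemma edxx x : ed x x = 0.
Proof. by rewrite /ed big1 ?sqrtr0 // => i _; rewrite subrr expr0n. Qed.

Lemma coord_le_ed x y i : `|x 0 i - y 0 i| <= ed x y.
Proof.
rewrite -(ler_pXn2r (n := 2)) ?nnegrE ?ed_ge0 // ed_sqr real_normK ?num_real //.
by rewrite (bigD1 i) //= lerDl sumr_ge0 // => j _; exact: sqr_ge0.
Qed.

Lemma ed_triangle y x z : ed x z <= ed x y + ed y z.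
Proof.
apply: ed_le; first by rewrite addr_ge0 // ed_ge0.
have -> : \sum_i (x 0 i - z 0 i) ^+ 2 = ed x y ^+ 2 + ed y z ^+ 2 +
    2 * \sum_i (x 0 i - y 0 i) * (y 0 i - z 0 i).
  by rewrite !ed_sqr mulr_sumr -!big_split /=; apply: eq_bigr => i _; ring.
have := sum_cauchy_schwarz (index_enum 'I_n) xpredT
  (fun i => x 0 i - y 0 i) (fun i => y 0 i - z 0 i).
rewrite -!ed_sqr -exprMn => CS.
have le : \sum_i (x 0 i - y 0 i) * (y 0 i - z 0 i) <= ed x y * ed y z.
  apply: le_trans (ler_norm _) _.
  rewrite -(ler_pXn2r (n := 2)) ?nnegrE ?mulr_ge0 ?ed_ge0 //.
  by rewrite real_normK ?num_real.
by rewrite sqrrD; lra.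
Qed.

Lemma stewart p x y t :
  ed p ((1 - t) *: x + t *: y) ^+ 2 =
  (1 - t) * ed p x ^+ 2 + t * ed p y ^+ 2 - t * (1 - t) * ed x y ^+ 2.
Proof.
rewrite !ed_sqr !mulr_sumr -sumrN -!big_split /=.
by apply: eq_bigr => i _; rewrite !mxE; ring.
Qed.

Lemma ed_lerpl x y t : 0 <= t -> ed x ((1 - t) *: x + t *: y) = t * ed x y.
Proof.
move=> t0; apply/eqP; rewrite -(eqrXn2 (n := 2)) ?mulr_ge0 ?ed_ge0 //.
by rewrite stewart edxx; apply/eqP; ring.
Qed.

Lemma ed_lerpr x y t : t <= 1 -> ed ((1 - t) *: x + t *: y) y = (1 - t) * ed x y.
Proof.
move=> t1; apply/eqP; rewrite -(eqrXn2 (n := 2)) ?mulr_ge0 ?ed_ge0 ?subr_ge0 //.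
by rewrite edC stewart edxx (edC y x); apply/eqP; ring.
Qed.

Lemma lerp_sub x y s t :
  ed ((1 - s) *: x + s *: y) ((1 - t) *: x + t *: y) = `|s - t| * ed x y.
Proof.
apply/eqP; rewrite -(eqrXn2 (n := 2)) ?mulr_ge0 ?ed_ge0 // exprMn.
rewrite real_normK ?num_real // !ed_sqr mulr_sumr; apply/eqP/eq_bigr => i _.
by rewrite !mxE; ring.
Qed.

(** Stewart's identity gives distance 0 between the two points. Consequently an isometry between
    faces is affine on segments. *)
Lemma lerp_unique x y z t : 0 <= t <= 1 -> ed x z = t * ed x y ->
  ed z y = (1 - t) * ed x y -> z = (1 - t) *: x + t *: y.
Proof.
move=> t01 xz zy; apply: ed_eq0; apply/eqP; rewrite -sqrf_eq0 stewart.
by rewrite (edC z x) xz zy; apply/eqP; ring.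
Qed.

Definition upd x (i : 'I_n) (s : R) : 'rV[R]_n :=
  \row_j (if j == i then s else x 0 j).

Definition flip x i := upd x i (- x 0 i).

Lemma upd_same x i s : upd x i s 0 i = s.
Proof. by rewrite mxE eqxx. Qed.

Lemma upd_other x i s j : j != i -> upd x i s 0 j = x 0 j.
Proof. by rewrite mxE => /negbTE ->. Qed.

Lemma updE x i : upd x i (x 0 i) = x.
Proof. by apply/rowP => j; rewrite mxE; case: eqP => // ->. Qed.

Lemma upd_upd x i s t : upd (upd x i s) i t = upd x i t.
Proof. by apply/rowP => j; rewrite !mxE; case: eqP. Qed.

Lemma ed_upd2 x y i s t :
  ed (upd x i s) (upd y i t) ^+ 2 = ed x y ^+ 2 - (x 0 i - y 0 i) ^+ 2 + (s - t) ^+ 2.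
Proof.
rewrite !ed_sqr (bigD1 i) //= [X in _ = X - _ + _](bigD1 i) //= !upd_same.
have -> : \sum_(j | j != i) (upd x i s 0 j - upd y i t 0 j) ^+ 2 =
          \sum_(j | j != i) (x 0 j - y 0 j) ^+ 2.
  by apply: eq_bigr => j ji; rewrite !upd_other.
by rewrite [RHS]addrC addrAC subrr add0r.
Qed.

Lemma ed_upd x i s t : ed (upd x i s) (upd x i t) = `|s - t|.
Proof.
apply/eqP; rewrite -(eqrXn2 (n := 2)) ?ed_ge0 //.
by rewrite ed_upd2 edxx subrr real_normK ?num_real //; apply/eqP; ring.
Qed.

Lemma lerp_upd x i s t u :
  (1 - u) *: upd x i s + u *: upd x i t = upd x i ((1 - u) * s + u * t).
Proof. by apply/rowP => j; rewrite !mxE; case: eqP => // _; ring. Qed.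

End Euclid.

Section CubeFaces.
Variables (R : realType) (n : nat).
Implicit Types x y z : 'rV[R]_n.

Lemma cube_suppxx x : cube x -> cube_supp x x.
Proof. by []. Qed.

Lemma cube_supp_trans x y z : cube_supp x y -> cube_supp y z -> cube_supp x z.
Proof.
move=> [_ xy] [cz yz]; split=> // i xi; rewrite -(xy _ xi) yz //.
by rewrite xy.
Qed.

Lemma cube_lerp x y t : cube x -> cube y -> 0 <= t <= 1 ->
  cube ((1 - t) *: x + t *: y).
Proof.
move=> cx cy /andP[t0 t1] i; rewrite !mxE.
have := cx i; have := cy i; rewrite !ler_norml => /andP[? ?] /andP[? ?].
by apply/andP; split; nra.
Qed.

Lemma cube_supp_lerp x y z t : cube_supp x y -> cube_supp x z -> 0 <= t <= 1 ->
  cube_supp x ((1 - t) *: y + t *: z).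
Proof.
move=> [cy xy] [cz xz] t01; split; first exact: cube_lerp.
by move=> i xi; rewrite !mxE xy // xz // -mulrDl subrK mul1r.
Qed.

Lemma cube_upd x i s : cube x -> `|s| <= 2^-1 -> cube (upd x i s).
Proof. by move=> cx s2 j; rewrite mxE; case: eqP => // _; exact: cx. Qed.

Lemma cube_supp_upd x y i s : `|x 0 i| < 2^-1 -> cube_supp x y ->
  `|s| <= 2^-1 -> cube_supp x (upd y i s).
Proof.
move=> xi [cy xy] s2; split; first exact: cube_upd.
move=> j xj; have [ji|ji] := eqVneq j i; last by rewrite upd_other ?xy.
by move: xi; rewrite -ji xj ltxx.
Qed.

(** [2^-1] and [- 2^-1] are the extreme points of the interval in which each coordinate varies. *)
Lemma lerp_extreme x y z t i : cube y -> cube z -> 0 < t < 1 ->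
  x = (1 - t) *: y + t *: z -> `|x 0 i| = 2^-1 -> y 0 i = x 0 i /\ z 0 i = x 0 i.
Proof.
move=> /(_ i) cy /(_ i) cz /andP[t0 t1] ->; rewrite !mxE.
move: (y 0 i) (z 0 i) cy cz => a b; rewrite !ler_norml => /andP[? ?] /andP[? ?].
have key u v : u <= 2^-1 -> v <= 2^-1 -> (1 - t) * u + t * v = 2^-1 :> R ->
    u = 2^-1 /\ v = 2^-1.
  move=> u2 v2 uv; split; apply/eqP; rewrite eq_le.
    by rewrite u2 -(ler_pM2l (_ : 0 < 1 - t)) ?subr_gt0 //; nra.
  by rewrite v2 -(ler_pM2l t0); nra.
case: (ger0P ((1 - t) * a + t * b)) => _ E.
  by have [] := key a b _ _ E => // -> ->; split; ring.
have [na nb] : - a <= 2^-1 /\ - b <= 2^-1 by split; lra.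
have [|a2 b2] := key _ _ na nb; first by rewrite -E; ring.
have -> : a = - 2^-1 by rewrite -a2 opprK.
have -> : b = - 2^-1 by rewrite -b2 opprK.
by split; ring.
Qed.

(** The gap [g] is a radius around [x] within which the cube has no face avoiding [x], see
    [deep_near]. *)
Definition deep (g : R) x := forall i, `|x 0 i| = 2^-1 \/ `|x 0 i| <= 2^-1 - g.

Lemma exists_deep x : cube x -> exists g, [/\ 0 < g, g <= 1 & deep g x].
Proof.
move=> cx; pose F i := if `|x 0 i| < 2^-1 then 2^-1 - `|x 0 i| else 1.
exists (\big[Num.min/1]_i F i); split.
- apply: lt_bigmin => // i _; rewrite /F; case: ifP => //.
  by rewrite subr_gt0.
- exact: bigmin_le_id.
move=> i; have := cx i; rewrite le_eqVlt => /orP[/eqP ->|xi]; [by left|right].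
by rewrite lerBrDr addrC -lerBrDr; apply: le_trans (bigmin_le _ i _) _; rewrite /F xi.
Qed.

(** [x] is interior to its smallest face, so the segment from [y] to [x] can be prolonged beyond
    [x]. *)
Lemma cube_supp_extend x y : cube x -> cube_supp x y ->
  exists t z, [/\ 0 < t < 1, cube_supp x z & x = (1 - t) *: y + t *: z].
Proof.
move=> cx [cy xy]; have [g [g0 g1 dx]] := exists_deep cx.
have g1' : 0 < 1 + g by rewrite addr_gt0.
(* A free coordinate of [x] has room [g], and it moves by at most [g] because the cube has side
   1. *)
exists (1 + g)^-1, (x + g *: (x - y)); split.
- by rewrite invr_gt0 g1' invf_lt1 // ltrDl.
- split=> i; rewrite !mxE; last by move=> /xy ->; rewrite subrr mulr0 addr0.
  have [xi|] := dx i; first by rewrite (xy _ xi) subrr mulr0 addr0.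
  have := cy i; rewrite !ler_norml => /andP[? ?] /andP[? ?].
  by apply/andP; split; nra.
- by apply/rowP => i; rewrite !mxE; field; rewrite lt0r_neq0.
Qed.

(** A boundary coordinate of [y] forces the same coordinate of [x] to the boundary, and to the same
    side, since the two sides are 1 apart. *)
Lemma deep_near g x y : g <= 1 -> deep g x -> cube x -> cube y ->
  ed x y < g -> cube_supp y x.
Proof.
move=> g1 dx cx cy xy; split=> // i yi.
have := le_lt_trans (coord_le_ed x y i) xy.
have [xi|xi] := dx i; last first.
  by have := lerB_dist (y 0 i) (x 0 i); rewrite yi distrC; lra.
case: (ger0P (x 0 i)) xi => _ xi; case: (ger0P (y 0 i)) yi => _ yi;
  by rewrite ltr_norml => /andP[]; lra.
Qed.

(** Together with [chart_inj] this keeps distinct preimages of one point in one cube at distance at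
    least [g]. *)
Lemma deep_unique g x y : g <= 1 -> deep g x -> deep g y -> cube x -> cube y ->
  ed x y < g -> cube_supp x = cube_supp y.
Proof.
move=> g1 dx dy cx cy xy; apply/seteqP; split => z; apply: cube_supp_trans.
  by apply: (deep_near g1 dx) => //.
by apply: (deep_near g1 dy) => //; rewrite edC.
Qed.

Lemma cube_supp_corner x : cube x -> exists a,
  [/\ corner a, cube_supp x a & forall i, `|x 0 i| < 2^-1 -> a 0 i = 2^-1].
Proof.
move=> cx; exists (\row_j (if `|x 0 j| < 2^-1 then 2^-1 else x 0 j)).
have half : `|2^-1| = 2^-1 :> R by rewrite ger0_norm ?invr_ge0.
have ac : corner (\row_j (if `|x 0 j| < 2^-1 then 2^-1 else x 0 j)).
  by move=> j; rewrite mxE; case: ltP => // xj; apply/eqP; rewrite eq_le cx.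
split=> // [|i xi]; last by rewrite mxE xi.
by split=> j; rewrite ?ac // => xj; rewrite mxE xj ltxx.
Qed.

Lemma corner_cube x : corner x -> cube x.
Proof. by move=> xc i; rewrite xc. Qed.

Lemma corner_flip x i : corner x -> corner (flip x i).
Proof. by move=> xc j; rewrite mxE; case: eqP => // _; rewrite normrN. Qed.

Lemma flipK x i : flip (flip x i) i = x.
Proof. by rewrite /flip upd_same opprK upd_upd updE. Qed.

Lemma ed_flip x i : corner x -> ed x (flip x i) = 1.
Proof.
move=> /(_ i) xi; rewrite -{1}[x](updE _ i) ed_upd opprK -mulr2n normrMn xi.
by rewrite -[_ *+ 2]mulr_natr mulVf.
Qed.

End CubeFaces.

(** * Isometries between faces of cubes *)

Section Gluing.
Variables (R : realType) (m n : nat) (h : 'rV[R]_m -> 'rV[R]_n).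
Variables (x : 'rV[R]_m) (x' : 'rV[R]_n).
Hypothesis h_onto : h @` cube_supp x = cube_supp x'.
Hypothesis h_isom : forall y z, cube_supp x y -> cube_supp x z ->
  ed (h y) (h z) = ed y z.
Hypotheses (cx : cube x) (cx' : cube x').

Let h_supp y : cube_supp x y -> cube_supp x' (h y).
Proof. by move=> xy; rewrite -h_onto; exists y. Qed.

Let h_lerp y z t : cube_supp x y -> cube_supp x z -> 0 <= t <= 1 ->
  h ((1 - t) *: y + t *: z) = (1 - t) *: h y + t *: h z.
Proof.
move=> xy xz t01; have /andP[t0 t1] := t01; have xt := cube_supp_lerp xy xz t01.
by apply: lerp_unique => //; rewrite !h_isom ?ed_lerpl ?ed_lerpr.
Qed.

(** Each [y] in the face of [x] is an end of a segment through [x], on which [h] is affine. By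
    extremality, a boundary coordinate of [h x] is shared by [h y], hence by the whole face of
    [x']. *)
Lemma face_isom_center : cube_supp (h x) = cube_supp x'.
Proof.
have hx := h_supp (cube_suppxx cx); apply/seteqP; split => y'.
  exact: cube_supp_trans.
rewrite -{1}h_onto => -[y xy <-].
have [t [z [t01 xz xE]]] := cube_supp_extend cx xy.
have [cy _] := h_supp xy; have [cz _] := h_supp xz; split=> // i hxi.
have t01' : 0 <= t <= 1 by case/andP: t01 => /ltW -> /ltW ->.
suff hxE : h x = (1 - t) *: h y + t *: h z by case: (lerp_extreme cy cz t01 hxE hxi).
by rewrite {1}xE h_lerp.
Qed.

(** Corners are extreme points: if [h y] had a free coordinate it would be the midpoint of two
    points of its face, whose preimages would have the midpoint [y]. *)
Lemma face_isom_corner y : cube_supp x y -> corner y -> corner (h y).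
Proof.
move=> xy yc i; have [cy' xy'] := h_supp xy.
move: (cy' i); rewrite le_eqVlt => /orP[/eqP //|yi]; exfalso.
have x'i : `|x' 0 i| < 2^-1.
  by rewrite lt_neqAle cx' andbT; apply/eqP => /[dup] /xy' E; rewrite -E => F;
     rewrite F ltxx in yi.
pose d := 2^-1 - `|h y 0 i|; have d0 : 0 < d by rewrite subr_gt0.
have up s : `|s| <= d -> exists2 a, cube_supp x a & h a = upd (h y) i (h y 0 i + s).
  move=> sd; have : cube_supp x' (upd (h y) i (h y 0 i + s)).
    apply: (cube_supp_upd x'i (h_supp xy)).
    by apply: le_trans (ler_normD _ _) _; rewrite /d in sd; lra.
  by rewrite -h_onto => -[a xa <-]; exists a.
have [a xa ha] : exists2 a, cube_supp x a & h a = upd (h y) i (h y 0 i + d).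
  by apply: (up d); rewrite (ger0_norm (ltW d0)).
have [b xb hb] : exists2 b, cube_supp x b & h b = upd (h y) i (h y 0 i - d).
  by apply: (up (- d)); rewrite normrN (ger0_norm (ltW d0)).
have half01 : 0 < (2^-1 : R) < 1 by rewrite invr_gt0 ltr0n invf_lt1 ?ltr1n ?ltr0n.
have yE : y = (1 - 2^-1) *: a + 2^-1 *: b.
  apply: ed_eq0; rewrite -h_isom //; last first.
    by apply: cube_supp_lerp => //; case/andP: half01 => /ltW -> /ltW ->.
  rewrite h_lerp //; last by case/andP: half01 => /ltW -> /ltW ->.
  rewrite ha hb lerp_upd; set u := (X in upd _ _ X).
  have -> : u = h y 0 i by rewrite /u; by field.
  by rewrite updE edxx.
have [ca _] := xa; have [cb _] := xb.
have ab : a = b.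
  by apply/rowP => j; have [-> ->] := lerp_extreme ca cb half01 yE (yc j).
have := upd_same (h y) i (h y 0 i + d); rewrite -ha ab hb upd_same; lra.
Qed.

(** The corners [a] and [flip a i] go to corners at distance 1, which differ in a single coordinate
    [i']. The distances from a point to these two corners determine its coordinate. *)
Lemma face_isom_coord i : `|x 0 i| < 2^-1 -> exists (i' : 'I_n) (e : R),
  e ^+ 2 = 1 /\ forall y s, cube_supp x y -> `|s| <= 2^-1 ->
    h y 0 i' = e * y 0 i /\ h (upd y i s) = upd (h y) i' (e * s).
Proof.
move=> xi.
have [a [ac xa /(_ i xi) ai]] := cube_supp_corner cx.
have fac := corner_flip i ac.
have xfa : cube_supp x (flip a i) by apply: cube_supp_upd; rewrite // normrN ac.
have dist1 : ed (h a) (h (flip a i)) = 1 by rewrite h_isom // ed_flip.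
have [i' hi'] : exists i', h a 0 i' != h (flip a i) 0 i'.
  apply/existsP; rewrite -negb_forall; apply/negP => /forallP E.
  suff F : h a = h (flip a i).
    by move: dist1; rewrite F edxx => /eqP; rewrite eq_sym oner_eq0.
  by apply/rowP => j; apply/eqP; exact: E.
have hac := face_isom_corner xa ac i'; have hfac := face_isom_corner xfa fac i'.
(* As [a 0 i] is [2^-1], this is the quotient of [h a 0 i'] by [a 0 i]. *)
pose e := h a 0 i' *+ 2.
have e2 : e ^+ 2 = 1.
  rewrite /e -mulr_natr exprMn -[h a 0 i' ^+ 2]real_normK ?num_real // hac; by field.
have hf : h (flip a i) 0 i' = - h a 0 i'.
  by move/eqP: hfac; rewrite -hac eqr_norm2 eq_sym (negbTE hi') => /eqP.
have d2 (u v : 'rV[R]_n) k : ed u v ^+ 2 = (u 0 k - v 0 k) ^+ 2 -> v = upd u k (v 0 k).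
  rewrite ed_sqr (bigD1 k) //= => /eqP; rewrite addrC -subr_eq0 addrK => /eqP.
  move/psumr_eq0P => uv; apply/rowP => j; rewrite mxE; case: eqP => [->//|/eqP jk].
  by apply/esym/eqP; rewrite -subr_eq0 -sqrf_eq0 uv // => l _; exact: sqr_ge0.
have hfE : h (flip a i) = flip (h a) i'.
  rewrite /flip -hf; apply: d2; rewrite dist1 hf opprK -mulr2n -[_ *+ 2]/e e2.
  by rewrite expr1n.
(* The difference of the squared distances to the two corners is linear in the coordinate. *)
have coord y : cube_supp x y -> h y 0 i' = e * y 0 i.
  move=> xy; have F := congr1 (fun r => r ^+ 2) (h_isom xy xa).
  have := congr1 (fun r => r ^+ 2) (h_isom xy xfa).
  rewrite /= hfE -{1}[h y](updE _ i') /flip ed_upd2 F.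
  rewrite -[X in ed X (upd a _ _)](updE _ i) ed_upd2 ai => E.
  have {}E : h y 0 i' * h a 0 i' = y 0 i * 2^-1 by lra.
  have : e * (h y 0 i' * h a 0 i') *+ 2 = e * (y 0 i * 2^-1) *+ 2 by rewrite E.
  rewrite (_ : e * (h y 0 i' * h a 0 i') *+ 2 = e ^+ 2 * h y 0 i'); last first.
    by rewrite /e; ring.
  by rewrite e2 mul1r => ->; by field.
exists i', e; split=> // y s xy s2; split; first exact: coord.
have xys : cube_supp x (upd y i s) by exact: cube_supp_upd.
have <- : h (upd y i s) 0 i' = e * s by rewrite coord // upd_same.
apply: d2; rewrite !coord // h_isom // -{1}[y](updE _ i) ed_upd upd_same.
by rewrite real_normK ?num_real // -mulrBr exprMn e2 mul1r.
Qed.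

End Gluing.

Section ComplexGluing.
Variables (R : realType) (X : Type) (K : cube_complex R X).

(* [i'] and [e] describe [h] as a signed permutation of the coordinates that
   are free on the face of [x]. *)
Lemma chart_gluing c c' (x : 'rV[R]_(dim K c)) (x' : 'rV[R]_(dim K c')) :
  cube x -> cube x' -> chart x = chart x' ->
  exists h : 'rV[R]_(dim K c) -> 'rV[R]_(dim K c'),
  [/\ forall y, cube_supp x y -> cube_supp x' (h y) /\ chart (h y) = chart y,
      forall y z, cube_supp x y -> cube_supp x z -> ed (h y) (h z) = ed y z,
      h x = x',
      forall y, cube_supp x y -> corner y -> corner (h y)
    & forall i, `|x 0 i| < 2^-1 -> exists i' e, e ^+ 2 = 1 /\
        forall y s, cube_supp x y -> `|s| <= 2^-1 ->
        h y 0 i' = e * y 0 i /\ h (upd y i s) = upd (h y) i' (e * s)].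
Proof.
move=> cx cx' xx'; have [h [h_onto h_isom h_chart]] := chart_glue cx cx' xx'.
have hs y : cube_supp x y -> cube_supp x' (h y).
  by move=> xy; rewrite -h_onto; exists y.
exists h; split.
- by move=> y xy; split; [exact: hs|exact/esym/h_chart].
- exact: h_isom.
- have [chx _] := hs _ (cube_suppxx cx).
  apply: (@chart_inj _ _ K c') => //; first exact: face_isom_center.
  by rewrite -h_chart //; exact: cube_suppxx.
- by move=> y; apply: (face_isom_corner h_onto h_isom).
- by move=> i; apply: (face_isom_coord h_onto h_isom).
Qed.

(** Up to sign, each free coordinate of [x'] is a coordinate of [x]; depth is thus a property of the
    point of [X]. *)
Lemma deep_transfer g c c' (x : 'rV[R]_(dim K c)) (x' : 'rV[R]_(dim K c')) :
  cube x -> cube x' -> chart x = chart x' -> deep g x -> deep g x'.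
Proof.
move=> cx cx' /esym xx' dx i; move: (cx' i); rewrite le_eqVlt.
case/orP => [/eqP|x'i]; [by left|right].
have [h [_ _ hx _ /(_ i x'i)[i' [e [e2 he]]]]] := chart_gluing cx' cx xx'.
have half : `|2^-1| <= 2^-1 :> R by rewrite ger0_norm ?invr_ge0.
have [xi _] := he _ _ (cube_suppxx cx') half.
have {}xi : `|x 0 i'| = `|x' 0 i| by rewrite -hx xi normrM norm_sqr1 // mul1r.
by have [] := dx i'; rewrite xi // => E; rewrite E ltxx in x'i.
Qed.

End ComplexGluing.

(** * The CAT(0) inequality *)

Section ComparisonTriangles.
Variable R : realType.

Definition row2 (u v : R) : 'rV[R]_2 := \row_j (if j == 0 then u else v).

Lemma ed_row2 u v u' v' d : 0 <= d -> (u - u') ^+ 2 + (v - v') ^+ 2 = d ^+ 2 ->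
  ed (row2 u v) (row2 u' v') = d.
Proof.
move=> d0 E; rewrite /euclidean_dist !big_ord_recl big_ord0 !mxE /= addr0.
by rewrite E sqrtr_sqr ger0_norm.
Qed.

(** [Q] is the origin and [S] lies on the first axis. The law of cosines gives the first coordinate
    [u] of [P], and the factorization in Heron's formula makes its height real. *)
Lemma comparison_points (a b c : R) : 0 <= a -> 0 <= b -> 0 <= c ->
  a <= b + c -> b <= a + c -> c <= a + b ->
  exists P Q S : 'rV[R]_2, [/\ ed P Q = c, ed Q S = a & ed P S = b].
Proof.
move=> a0 b0 c0 abc bac cab; have [a_0|an0] := eqVneq a 0.
  have bc : b = c by lra.
  by exists (row2 c 0), (row2 0 0), (row2 0 0); split; apply: ed_row2 => //;
    rewrite ?a_0 ?bc; ring.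
have ap : 0 < a by rewrite lt_def an0.
pose u := (c ^+ 2 + a ^+ 2 - b ^+ 2) / (2 * a).
have ua : 2 * a * u = c ^+ 2 + a ^+ 2 - b ^+ 2 by rewrite /u; field.
have uc : u ^+ 2 <= c ^+ 2.
  suff : (2 * a * u) ^+ 2 <= (2 * a * c) ^+ 2.
    by rewrite !(exprMn _ (2 * a)) ler_pM2l // exprn_gt0 // mulr_gt0.
  rewrite ua -subr_ge0.
  have -> : (2 * a * c) ^+ 2 - (c ^+ 2 + a ^+ 2 - b ^+ 2) ^+ 2 =
     ((b + c - a) * (a + b - c)) * ((a + c - b) * (a + b + c)) by ring.
  by rewrite !mulr_ge0 //; lra.
have v2 : Num.sqrt (c ^+ 2 - u ^+ 2) ^+ 2 = c ^+ 2 - u ^+ 2.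
  by rewrite sqr_sqrtr // subr_ge0.
exists (row2 u (Num.sqrt (c ^+ 2 - u ^+ 2))), (row2 0 0), (row2 a 0).
split; apply: ed_row2 => //; rewrite ?subr0 ?v2; try ring.
by rewrite sqrrB; lra.
Qed.

End ComparisonTriangles.

(** * The CN inequality and its consequences *)

Section CAT0Facts.
Variables (R : realType) (X : metricType R).
Hypothesis HX : CAT0 X.
Local Notation d := (@mdist R X).

(** The Bruhat-Tits inequality: in the comparison triangle, Stewart's identity computes the distance
    from a corner to a point of the opposite side. *)
Lemma geodesic_cn p q r c t : geodesic q r c -> 0 <= t <= 1 ->
  d p (c (t * d q r)) ^+ 2 <=
  (1 - t) * d p q ^+ 2 + t * d p r ^+ 2 - t * (1 - t) * d q r ^+ 2.
Proof.
move=> qrc /andP[t0 t1]; have [geo cat] := HX.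
have [c0 pqc] := geo p q; have [c2 rpc] := geo r p.
have [||| P [Q [S [PQ QS PS]]]] :=
    comparison_points (mdist_ge0 q r) (mdist_ge0 p r) (mdist_ge0 p q).
- by rewrite addrC (metric_sym p q) metric_triangle.
- by rewrite addrC metric_triangle.
- by rewrite addrC (metric_sym q r) metric_triangle.
pose v (i : 'I_3) := nth p [:: p; q; r] i.
pose side (i : 'I_3) := nth c0 [:: c0; c; c2] i.
pose w (i : 'I_3) := nth P [:: P; Q; S] i.
have tri : geodesic_triangle v side by case=> -[|[|[|]]].
have cmp : comparison_triangle v w.
  by case=> -[|[|[|//]]] ?; case=> -[|[|[|//]]] ?; rewrite /w /v /= ?edxx ?mdistxx //;
     rewrite edC metric_sym.
(* Side 1 runs from [q] to [r]; the point [p] is the start of side 0. *)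
have := cat v side w tri cmp (@Ordinal 3 1 isT) (@Ordinal 3 0 isT) (t * d q r) 0
  ((1 - t) *: Q + t *: S) P.
rewrite /v /w /side /=; have [-> _ _] := pqc; rewrite (metric_sym _ p) (edC _ P) => le.
have := stewart P Q S t; rewrite PQ QS PS => <-.
rewrite ler_pXn2r ?nnegrE ?mdist_ge0 ?ed_ge0 //; apply: le.
- by rewrite mulr_ge0 ?mdist_ge0 //= ler_piMl ?mdist_ge0.
- by rewrite lexx mdist_ge0.
- split; first by rewrite ed_lerpl // QS.
  by exists t; rewrite t0 t1.
- split; first exact: edxx.
  by exists 0; rewrite lexx ler01 subr0 scale1r scale0r addr0.
Qed.

(** For [p := m] the right side of [geodesic_cn] is 0. *)
Lemma geodesic_point q r m c t : geodesic q r c -> 0 <= t <= 1 ->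
  d q m = t * d q r -> d m r = (1 - t) * d q r -> c (t * d q r) = m.
Proof.
move=> qrc t01 qm mr; apply/esym/mdist_positivity/eqP; rewrite -sqrf_eq0.
rewrite eq_le sqr_ge0 andbT; apply: le_trans (geodesic_cn m qrc t01) _.
by rewrite (metric_sym m q) qm mr; rewrite le_eqVlt; apply/orP; left; apply/eqP; ring.
Qed.

Lemma CAT0_cn p q r m t : 0 <= t <= 1 ->
  d q m = t * d q r -> d m r = (1 - t) * d q r ->
  d p m ^+ 2 <= (1 - t) * d p q ^+ 2 + t * d p r ^+ 2 - t * (1 - t) * d q r ^+ 2.
Proof.
move=> t01 qm mr; have [geo _] := HX; have [c qrc] := geo q r.
by rewrite -(geodesic_point qrc t01 qm mr) geodesic_cn.
Qed.

Lemma CAT0_midpoint p q r m h : d q m = h -> d m r = h -> d q r = 2 * h ->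
  d p m ^+ 2 *+ 2 <= d p q ^+ 2 + d p r ^+ 2 - h ^+ 2 *+ 2.
Proof.
move=> qm mr qr; have half : 0 <= (2^-1 : R) <= 1 by rewrite invr_ge0 ler0n invf_le1 ?ler1n ?ltr0n.
have := @CAT0_cn p q r m _ half; rewrite qm mr qr.
have E1 : h = 2^-1 * (2 * h) by field.
have E2 : h = (1 - 2^-1) * (2 * h) by field.
by move=> /(_ E1 E2); lra.
Qed.

(** The mean of the squares exceeds the square of the mean by [t * (1 - t)] times the squared
    difference of [d p q] and [d p r], which is at most [d q r ^+ 2]. *)
Lemma CAT0_convex p q r m t : 0 <= t <= 1 ->
  d q m = t * d q r -> d m r = (1 - t) * d q r ->
  d p m <= (1 - t) * d p q + t * d p r.
Proof.
move=> t01 qm mr; have := CAT0_cn p t01 qm mr; have /andP[t0 t1] := t01.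
have := metric_triangle q p r; have := metric_triangle p q r.
have := metric_triangle p r q; rewrite (metric_sym q p) (metric_sym r q).
have := mdist_ge0 p q; have := mdist_ge0 p r; have := mdist_ge0 q r.
move: (d p q) (d p r) (d q r) (d p m) (mdist_ge0 p m) => a b l e e0 l0 b0 a0 ab ba abl le.
have t1' : 0 <= 1 - t by lra.
rewrite -(ler_pXn2r (n := 2)) ?nnegrE ?addr_ge0 ?mulr_ge0 //; apply: le_trans le _.
rewrite -subr_ge0 (_ : _ - _ = t * (1 - t) * ((l - (a - b)) * (l + (a - b)))); last ring.
by rewrite !mulr_ge0 //; lra.
Qed.

(* The midpoint inequality makes the squared distance to [g 0] grow at least
   quadratically. *)
Lemma local_geodesic (g : nat -> X) (h : R) (N : nat) : 0 <= h ->
  (forall k, (k < N)%N -> d (g k) (g k.+1) = h) ->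
  (forall k, (k.+1 < N)%N -> d (g k) (g k.+2) = 2 * h) ->
  d (g 0%N) (g N) = N%:R * h.
Proof.
move=> h0 g1 g2.
(* This sequence is convex and vanishes at 0 and 1, hence it is nonnegative and nondecreasing. *)
pose b k := d (g 0%N) (g k) ^+ 2 - (k%:R * h) ^+ 2.
have conv j : (j.+1 < N)%N -> b j.+1 *+ 2 <= b j + b j.+2.
  move=> jN; have := CAT0_midpoint (g 0%N) (g1 j (ltnW jN)) (g1 j.+1 jN) (g2 j jN).
  by rewrite /b -[j.+2%:R]natr1 -[j.+1%:R]natr1; lra.
have incr j : (j < N)%N -> 0 <= b j <= b j.+1.
  elim: j => [N0|j IH jN].
    by rewrite /b mdistxx g1 // mul0r mul1r expr0n !subrr lexx.
  by have /andP[b0 b1] := IH (ltnW jN); have := conv j jN; lra.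
apply/eqP; rewrite eq_le; apply/andP; split.
  have upper k : (k <= N)%N -> d (g 0%N) (g k) <= k%:R * h.
    elim: k => [|k IH kN]; first by rewrite mdistxx mul0r.
    have := metric_triangle (g 0%N) (g k) (g k.+1); have := IH (ltnW kN).
    by rewrite g1 // -natr1 mulrDl; lra.
  exact: upper.
rewrite -(ler_pXn2r (n := 2)) ?nnegrE ?mdist_ge0 ?mulr_ge0 // -subr_ge0.
case: N incr {g1 g2 conv} => [|N] incr; first by rewrite mdistxx mul0r subrr.
by have /andP[b0 b1] := incr N (ltnSn N); apply: le_trans b1.
Qed.

End CAT0Facts.

(** * Charts are isometric embeddings *)

Section LocalStructure.
Variables (R : realType) (X : metricType R) (K : cube_complex R X).
Hypothesis dist_induced : forall p q : X, induced_dist K p q = (mdist p q)%:E.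
Local Notation d := (@mdist R X).

Lemma chart_lipschitz c (a b : 'rV[R]_(dim K c)) : cube a -> cube b ->
  d (chart a) (chart b) <= ed a b.
Proof.
move=> ca cb; rewrite -lee_fin -dist_induced; apply: ereal_inf_lbound.
exists (ed a b + 0); last by rewrite addr0.
by apply: cube_string_cons => //; exact: cube_string_nil.
Qed.

Lemma short_string p q r : d p q < r -> exists2 l, cube_string K p q l & l < r.
Proof.
rewrite -lte_fin -dist_induced => /ereal_inf_lt[_ [l pql <-]].
by rewrite lte_fin => lr; exists l.
Qed.

Lemma string_ge0 p q l : cube_string K p q l -> 0 <= l.
Proof. by elim=> [//|p' q' c a b l' _ _ _ _]; exact/addr_ge0/ed_ge0. Qed.

Section Star.
Variables (z : X) (g : R).
Hypothesis g1 : g <= 1.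
Hypothesis z_deep : forall c (x : 'rV[R]_(dim K c)), cube x -> chart x = z -> deep g x.

Definition near r y := exists c (x0 x : 'rV[R]_(dim K c)),
  [/\ cube x0, cube x, chart x0 = z, chart x = y & ed x0 x <= r].

(** By depth [x0] lies in the smallest face of [x], which the gluing isometry carries into the other
    cube. *)
Lemma near_transfer c c' (x0 x : 'rV[R]_(dim K c)) (x' : 'rV[R]_(dim K c')) :
  cube x0 -> cube x -> cube x' -> chart x0 = z -> chart x = chart x' ->
  ed x0 x < g -> exists x0', [/\ cube x0', chart x0' = z & ed x0' x' = ed x0 x].
Proof.
move=> cx0 cx cx' zx0 xx' x0x.
have xx0 : cube_supp x x0 by apply: (deep_near g1 (z_deep cx0 zx0)).
have [h [hs hi hx _ _]] := chart_gluing cx cx' xx'.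
have [[ch _] hch] := hs _ xx0; exists (h x0); split=> //; first by rewrite hch.
by rewrite -hx hi // cube_suppxx.
Qed.

(** Before each link, [near_transfer] provides a preimage of [z] in the cube of that link; a short
    string therefore stays in cubes containing [z]. *)
Lemma near_string p q l r : cube_string K p q l -> near r p -> r + l < g ->
  near (r + l) q.
Proof.
move=> S; elim: S r => [p'|{}p {}q c a b {}l ca cb <- S IH] r; first by rewrite addr0.
move=> [c' [x0 [x [cx0 cx zx0 xa x0x]]]] rl; rewrite addrA; apply: IH; last by rewrite -addrA.
have l0 := string_ge0 S; have ab0 := ed_ge0 a b.
have [|a0 [ca0 za0 a0a]] := near_transfer cx0 cx ca zx0 xa; first by lra.
exists c, a0, b; split=> //; apply: le_trans (ed_triangle a _ _) _.
by rewrite a0a lerD2r.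
Qed.

(** The transfer of [x0] and the point [x0'] are preimages of [z] in one cube at distance less than
    [g], so they coincide. *)
Lemma near_exact c c' (x0 x : 'rV[R]_(dim K c)) (x0' x' : 'rV[R]_(dim K c')) :
  cube x0 -> cube x -> cube x0' -> cube x' -> chart x0 = z -> chart x0' = z ->
  chart x = chart x' -> ed x0 x < g / 2 -> ed x0' x' < g / 2 ->
  ed x0 x = ed x0' x'.
Proof.
move=> cx0 cx cx0' cx' zx0 zx0' xx' lt lt'.
have [|y0 [cy0 zy0 E]] := near_transfer cx0 cx cx' zx0 xx'.
  by have := ed_ge0 x0 x; lra.
suff <- : y0 = x0' by [].
apply: (@chart_inj _ _ K c') => //; last by rewrite zy0.
apply: (deep_unique g1 (z_deep cy0 zy0) (z_deep cx0' zx0')) => //.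
by apply: le_lt_trans (ed_triangle x' _ _) _; rewrite E (edC x'); lra.
Qed.

(** Strings of length near [d z y] give common cubes with distances near [d z y]. By [near_exact]
    all these distances are equal, so the infimum is attained. *)
Lemma star_ball y : d z y < g / 2 -> exists c (x0 x : 'rV[R]_(dim K c)),
  [/\ cube x0, cube x, chart x0 = z, chart x = y & ed x0 x = d z y].
Proof.
have near_y r : r <= g / 2 -> d z y < r -> exists c (x0 x : 'rV[R]_(dim K c)),
    [/\ cube x0, cube x, chart x0 = z, chart x = y & ed x0 x < r].
  move=> rg /short_string[l zyl lr]; have l0 := string_ge0 zyl.
  have [c [u [cu uz]]] := chart_surj K z.
  have z0 : near 0 z by exists c, u, u; split; rewrite ?edxx.
  have [|c' [x0 [x [cx0 cx zx0 xy x0x]]]] := near_string zyl z0; first by lra.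
  by exists c', x0, x; split=> //; rewrite add0r in x0x; exact: le_lt_trans lr.
move=> zy; have [c [x0 [x [cx0 cx zx0 xy lt]]]] := near_y _ (lexx _) zy.
exists c, x0, x; split=> //; apply/eqP; rewrite eq_le -{2}zx0 -{2}xy chart_lipschitz // andbT.
rewrite leNgt; apply/negP => /(near_y _ (ltW lt))[c' [u [v [cu cv zu vy uv]]]].
have := @near_exact _ _ x0 x u v cx0 cx cu cv zx0 zu.
by rewrite xy vy => /(_ erefl lt (lt_trans uv lt)) E; rewrite E ltxx in uv.
Qed.

Lemma star_exact c (x0 x : 'rV[R]_(dim K c)) : cube x0 -> cube x -> chart x0 = z ->
  ed x0 x < g / 2 -> d z (chart x) = ed x0 x.
Proof.
move=> cx0 cx zx0 lt; have [|c' [y0 [y [cy0 cy zy0 yx yy]]]] := @star_ball (chart x).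
  by apply: le_lt_trans lt; rewrite -zx0; exact: chart_lipschitz.
rewrite -yy; apply: near_exact => //.
by rewrite yy; apply: le_lt_trans lt; rewrite -zx0; exact: chart_lipschitz.
Qed.

End Star.

End LocalStructure.

Section CubesEmbed.
Variables (R : realType) (X : metricType R) (K : cube_complex R X).
Hypothesis dist_induced : forall p q : X, induced_dist K p q = (mdist p q)%:E.
Hypothesis HX : CAT0 X.
Local Notation d := (@mdist R X).

(** The depth of one preimage of [z] serves all its preimages by [deep_transfer]. *)
Lemma star_nbhs z : exists2 e, 0 < e & forall y, d z y < e ->
  exists c (x0 x : 'rV[R]_(dim K c)),
  [/\ cube x0, cube x, chart x0 = z & chart x = y].
Proof.
have [c [x [cx xz]]] := chart_surj K z; have [g [g0 g1 dx]] := exists_deep cx.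
exists (g / 2); first by rewrite divr_gt0.
have z_deep c' (x' : 'rV[R]_(dim K c')) : cube x' -> chart x' = z -> deep g x'.
  by move=> cx' x'z; apply: deep_transfer dx => //; rewrite x'z.
move=> y /(star_ball dist_induced g1 z_deep)[c' [x0 [x' [? ? ? ? _]]]].
by exists c', x0, x'.
Qed.

(** All points of the segment have depth [g], so its image is a local geodesic at a uniform scale,
    and [local_geodesic] makes it a geodesic. *)
Let chart_isometry_inner c (x y : 'rV[R]_(dim K c)) (g : R) : 0 < g <= 1 ->
  (forall i, `|x 0 i| <= 2^-1 - g) -> (forall i, `|y 0 i| <= 2^-1 - g) ->
  d (chart x) (chart y) = ed x y.
Proof.
move=> /andP[g0 g1] dx dy; pose l t : 'rV[R]_(dim K c) := (1 - t) *: x + t *: y.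
have dl t : 0 <= t <= 1 -> forall i, `|l t 0 i| <= 2^-1 - g.
  move=> /andP[t0 t1] i; have := dx i; have := dy i; rewrite !mxE !ler_norml.
  by move=> /andP[? ?] /andP[? ?]; apply/andP; split; nra.
have cl t : 0 <= t <= 1 -> cube (l t) by move=> /dl dt i; have := dt i; lra.
have exact_l t s : 0 <= t <= 1 -> 0 <= s <= 1 -> `|t - s| * ed x y < g / 2 ->
    d (chart (l t)) (chart (l s)) = `|t - s| * ed x y.
  move=> t01 s01 lt; rewrite -lerp_sub; apply: (star_exact dist_induced g1); rewrite ?lerp_sub //.
  - by move=> c' x' cx' x'l; apply: (@deep_transfer _ _ K g c c' (l t)) => //;
      [exact: cl | move=> i; right; exact: dl].
  - exact: cl.
  - exact: cl.
(* Two consecutive subdivision steps must together be shorter than [g / 2]. *)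
pose N := (Num.bound (4 * ed x y / g)).+1.
have hN : 2 * (ed x y / N%:R) < g / 2.
  have : 4 * ed x y / g < N%:R.
    apply: lt_trans (archi_boundP _) _; last by rewrite ltr_nat.
    by rewrite divr_ge0 ?mulr_ge0 ?ed_ge0 // ltW.
  rewrite ltr_pdivrMr // mulrA ltr_pdivrMr ?ltr0n //; lra.
have N0 : N%:R != 0 :> R by rewrite pnatr_eq0.
have step k j : (j <= N)%N -> (k <= j)%N -> (j - k <= 2)%N ->
    d (chart (l (k%:R / N%:R))) (chart (l (j%:R / N%:R))) = (j - k)%:R * (ed x y / N%:R).
  move=> jN kj jk2; have kN := leq_trans kj jN.
  have E : `|k%:R / N%:R - j%:R / N%:R| * ed x y = (j - k)%:R * (ed x y / N%:R).
    rewrite -mulrBl normrM distrC ger0_norm ?subr_ge0 ?ler_nat // -natrB //.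
    by rewrite ger0_norm ?invr_ge0 // -mulrA [_^-1 * _]mulrC.
  rewrite -E; apply: exact_l.
  - by rewrite divr_ge0 //= ler_pdivrMr ?ltr0n // mul1r ler_nat.
  - by rewrite divr_ge0 //= ler_pdivrMr ?ltr0n // mul1r ler_nat.
  rewrite E; apply: le_lt_trans hN; apply: ler_wpM2r.
    by rewrite divr_ge0 ?ed_ge0.
  by rewrite ler_nat.
have l0 : l (0%:R / N%:R) = x by rewrite /l mul0r subr0 scale1r scale0r addr0.
have lN : l (N%:R / N%:R) = y by rewrite /l divff // subrr scale0r scale1r add0r.
rewrite -[in LHS]l0 -[in LHS]lN.
have -> : ed x y = N%:R * (ed x y / N%:R) by rewrite mulrCA divff // mulr1.
apply: (@local_geodesic _ _ HX (fun k => chart (l (k%:R / N%:R)))).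
- by rewrite divr_ge0 ?ed_ge0.
- by move=> k kN; rewrite step ?subSnn ?mul1r.
- move=> k kN; have E : (k.+2 - k = 2)%N by lia.
  by rewrite step ?E //; lia.
Qed.

(** Contracting the cube slightly towards its centre moves both points to its interior, where the
    previous case applies. *)
Lemma chart_isometry c (x y : 'rV[R]_(dim K c)) : cube x -> cube y ->
  d (chart x) (chart y) = ed x y.
Proof.
move=> cx cy; apply/eqP; rewrite eq_le chart_lipschitz //= leNgt; apply/negP => lt.
(* Contraction by [1 - t] alters the compared distances by less than [t * M] in total; the summand 1
   keeps [M] positive. *)
pose M := ed x 0 + ed y 0 + ed x y + 1.
have M0 : 0 < M by rewrite /M; have := ed_ge0 x 0; have := ed_ge0 y 0; have := ed_ge0 x y; lra.
pose D := ed x y - d (chart x) (chart y); have D0 : 0 < D by rewrite subr_gt0.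
pose t := Num.min 2^-1 (D / (2 * M)).
have t0 : 0 < t by rewrite lt_min invr_gt0 ltr0n divr_gt0 // mulr_gt0.
have t2 : t <= 2^-1 by rewrite ge_min lexx.
have tM : t * M < D.
  apply: le_lt_trans (_ : D / (2 * M) * M < D).
    by rewrite ler_pM2r // ge_min lexx orbT.
  rewrite (_ : _ * M = D / 2); first by lra.
  by field; rewrite lt0r_neq0.
have c0 : cube (0 : 'rV[R]_(dim K c)) by move=> i; rewrite mxE normr0 invr_ge0.
have t01 : 0 <= t <= 1 by rewrite (ltW t0); lra.
have inner z : cube z -> forall i, `|((1 - t) *: z + t *: 0 : 'rV[R]_(dim K c)) 0 i| <= 2^-1 - t / 2.
  move=> cz i; rewrite !mxE mulr0 addr0 normrM ger0_norm; last by lra.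
  by have := cz i; nra.
have := @chart_isometry_inner c _ _ (t / 2) _ (inner x cx) (inner y cy).
set x' := _ + _; set y' := (1 - t) *: y + _.
have -> : ed x' y' = (1 - t) * ed x y.
  apply/eqP; rewrite -(eqrXn2 (n := 2)) ?mulr_ge0 ?ed_ge0 //; last by lra.
  rewrite exprMn !ed_sqr mulr_sumr; apply/eqP/eq_bigr => i _.
  by rewrite !mxE; ring.
move=> E; have {}E : d (chart x') (chart y') = (1 - t) * ed x y by apply: E; lra.
have cx' : cube x' by exact: cube_lerp.
have cy' : cube y' by exact: cube_lerp.
have := chart_lipschitz dist_induced cx cx'; have := chart_lipschitz dist_induced cy cy'.
rewrite !ed_lerpl //; try by lra.
have := metric_triangle (chart x') (chart x) (chart y').
have := metric_triangle (chart x) (chart y) (chart y').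
rewrite E (metric_sym (chart x')); move: tM; rewrite /D /M; lra.
Qed.

End CubesEmbed.

(** * Slices and halfspaces *)

Section Slices.
Variables (R : realType) (X : metricType R) (K : cube_complex R X).
Hypothesis dist_induced : forall p q : X, induced_dist K p q = (mdist p q)%:E.
Hypothesis HX : CAT0 X.
Local Notation d := (@mdist R X).
Let iso := chart_isometry dist_induced HX.

Variable Ed : X -> X -> Prop.

(** [Ed] will be either the relation that always holds or the set of edges dual to one
    hyperplane. *)
Definition parallel_closed := forall c (a b : 'rV[R]_(dim K c)) i,
  corner a -> corner b -> Ed (chart a) (chart (flip a i)) ->
  Ed (chart b) (chart (flip b i)).

Definition direction c (i : 'I_(dim K c)) :=
  forall a, corner a -> Ed (chart a) (chart (flip a i)).

Hypothesis Ed_closed : parallel_closed.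

Lemma direction_transfer c c' (x : 'rV[R]_(dim K c)) (x' : 'rV[R]_(dim K c')) i :
  cube x -> cube x' -> chart x = chart x' -> `|x 0 i| < 2^-1 -> direction i ->
  exists i' e, [/\ e ^+ 2 = 1, `|x' 0 i'| < 2^-1, direction i' &
    forall s, `|s| <= 2^-1 -> chart (upd x i s) = chart (upd x' i' (e * s))].
Proof.
move=> cx cx' xx' xi dir.
have [h [hs _ hx hc /(_ i xi)[i' [e [e1 he]]]]] := chart_gluing cx cx' xx'.
have ne := norm_sqr1 e1.
have xx := cube_suppxx cx.
exists i', e; split=> //.
- have [hxi _] := he _ _ xx (cx i).
  by rewrite -hx hxi normrM ne mul1r.
- have [a [ac xa _]] := cube_supp_corner cx.
  have ai : `|- a 0 i| <= 2^-1 by rewrite normrN ac.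
  have [hai hfa] := he _ _ xa ai.
  move=> b bc; apply: (Ed_closed (a := h a)) => //; first exact: hc.
  rewrite /flip hai -mulrN -hfa; have [_ ->] := hs _ xa.
  have [_ ->] := hs _ (cube_supp_upd xi xa ai); exact: dir.
move=> s s2; have [_ hu] := he _ _ xx s2; rewrite -hx -hu.
by have [_ ->] := hs _ (cube_supp_upd xi xx s2).
Qed.

Definition sliced q := exists c (x : 'rV[R]_(dim K c)) i,
  [/\ cube x, chart x = q, `|x 0 i| < 2^-1 & direction i].

(** Minimality along the line in direction [i] expresses, without angles, that the geodesic from [q]
    to [p] leaves perpendicularly to it. *)
Definition min_sliced p q := exists c (x : 'rV[R]_(dim K c)) i,
  [/\ cube x, chart x = q, `|x 0 i| < 2^-1, direction i &
      forall s, `|s| <= 2^-1 -> d q p <= d (chart (upd x i s)) p].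

(** A geodesic that changed height inside the cube could be shortened by first sliding [y] to the
    new height. Minimality at [y'] is a first variation argument. *)
Lemma min_sliced_step p c (y y' : 'rV[R]_(dim K c)) :
  cube y -> cube y' -> min_sliced p (chart y) ->
  d (chart y) p = d (chart y) (chart y') + d (chart y') p ->
  min_sliced p (chart y').
Proof.
move=> cy cy' [c0 [x [i0 [cx xy xi dir xmin]]]].
have [i [e [e1 yi {}dir tr]]] := direction_transfer cx cy xy xi dir.
have ymin s : `|s| <= 2^-1 -> d (chart y) p <= d (chart (upd y i s)) p.
  move=> s2; have := xmin (e * s).
  have es : `|e * s| <= 2^-1.
    have ne := norm_sqr1 e1.
    by rewrite normrM ne mul1r.
  by rewrite tr // mulrA -expr2 e1 mul1r; apply.
rewrite iso // => split_yp.
have height : y' 0 i = y 0 i.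
  have cw : cube (upd y i (y' 0 i)) by apply: cube_upd.
  have := metric_triangle (chart (upd y i (y' 0 i))) (chart y') p.
  have := ymin _ (cy' i); rewrite iso // split_yp => le1 le2.
  have : ed y y' <= ed (upd y i (y' 0 i)) y' by lra.
  rewrite -(ler_pXn2r (n := 2)) ?nnegrE ?ed_ge0 //.
  rewrite -{3}[y'](updE _ i) ed_upd2 subrr expr0n addr0 => le.
  have : (y 0 i - y' 0 i) ^+ 2 <= 0 by lra.
  by move=> le0; apply/esym/eqP; rewrite -subr_eq0 -sqrf_eq0 eq_le le0 sqr_ge0.
have [yy'|yy'] := eqVneq (ed y y') 0.
  by move/ed_eq0: yy' => <-; exists c, y, i.
have eps0 : 0 < ed y y' by rewrite lt_def yy' ed_ge0.
exists c, y', i; split; rewrite ?height // => s s2; rewrite leNgt; apply/negP => lt.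
pose k := d (chart y') p - d (chart (upd y' i s)) p; have k0 : 0 < k by rewrite subr_gt0.
pose sg := (y 0 i - s) ^+ 2; have sg0 : 0 <= sg by exact: sqr_ge0.
(* Moving [y'] by the fraction [l] towards height [s] brings it closer to [p] by at least [l * k],
   while its squared distance to [y] grows only by [l ^+ 2 * sg]. *)
pose l := Num.min 1 (ed y y' * k / (sg + 1)).
have l0 : 0 < l by rewrite lt_min ltr01 divr_gt0 ?mulr_gt0 // ltr_wpDl.
have l1 : l <= 1 by rewrite ge_min lexx.
have lsg : l * sg <= ed y y' * k.
  apply: le_trans (_ : ed y y' * k / (sg + 1) * sg <= _).
    by rewrite ler_wpM2r // ge_min lexx orbT.
  by rewrite mulrAC ler_pdivrMr ?ltr_wpDl // ler_wpM2l ?mulr_ge0 ?lerDl // ltW.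
have l01 : 0 <= l <= 1 by rewrite l1 ltW.
pose w := upd y' i ((1 - l) * y' 0 i + l * s).
have wE : w = (1 - l) *: y' + l *: upd y' i s.
  by apply/rowP => j; rewrite !mxE; case: eqP => [->|_]; ring.
have cs : cube (upd y' i s) by exact: cube_upd.
have cw : cube w by rewrite wE; exact: cube_lerp.
have /andP[l0' _] := l01.
have := @CAT0_convex _ _ HX p (chart y') (chart (upd y' i s)) (chart w) l l01.
rewrite !iso // {1 2}wE ed_lerpl // ed_lerpr // => /(_ erefl erefl).
rewrite !(metric_sym p) => conv.
have := metric_triangle (chart y) (chart w) p; rewrite split_yp iso // => tri.
have yw : ed y w ^+ 2 = ed y y' ^+ 2 + l ^+ 2 * sg.
  by rewrite /w -{1}[y](updE _ i) ed_upd2 height /sg; ring.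
have le : ed y y' + l * k <= ed y w by move: conv tri; rewrite /k; lra.
have : (ed y y' + l * k) ^+ 2 <= ed y w ^+ 2.
  by rewrite ler_pXn2r ?nnegrE ?ed_ge0 // addr_ge0 ?ed_ge0 // mulr_ge0 // ltW.
rewrite yw.
have -> : (ed y y' + l * k) ^+ 2 = ed y y' ^+ 2 + l * (ed y y' * k *+ 2) + (l * k) ^+ 2.
  by ring.
have := sqr_ge0 (l * k); have : l ^+ 2 * sg <= l * (ed y y' * k).
  by rewrite expr2 -mulrA ler_wpM2l.
have : 0 < l * (ed y y' * k) by rewrite !mulr_gt0.
by rewrite mulrnAr; lra.
Qed.

(* A geodesic that starts perpendicularly to the direction [i] stays in the
   slices of the cubes it meets, so the same holds for its end point. *)
Lemma sliced_endpoint p q : min_sliced p q -> sliced p.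
Proof.
move=> qp; have [geo _] := HX; have [c [c0 cL cc]] := geo q p.
set L := d q p in cL cc; have L0 : 0 <= L := mdist_ge0 _ _.
suff : min_sliced p p by move=> [c' [x [i [? ? ? ? _]]]]; exists c', x, i.
(* The supremum of [T] belongs to [T] and equals [L], because points of the geodesic near [c s]
   share a cube with [c s]. *)
pose T := [set t | 0 <= t <= L /\ min_sliced p (c t)].
have T0 : T 0 by rewrite /T /= lexx L0 c0.
have Tub : has_ubound T by exists L => t [] /andP[].
have step s t : 0 <= s <= t -> t <= L -> min_sliced p (c s) ->
    (exists c' (x0 x : 'rV[R]_(dim K c')),
      [/\ cube x0, cube x, chart x0 = c s & chart x = c t]) -> min_sliced p (c t).
  move=> /andP[s0 st] tL ms [c' [x0 [x [cx0 cx x0s xt]]]].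
  move: ms; rewrite -x0s -xt => ms; apply: (min_sliced_step cx0 cx ms).
  rewrite x0s xt -cL !cc ?L0 ?lexx ?s0 ?tL ?(le_trans st) ?(le_trans s0) //.
  by rewrite !ler0_norm ?subr_le0 ?(le_trans st) //; ring.
pose s := sup T; have Ts t : T t -> t <= s by move=> Tt; exact: ub_le_sup.
have s0 : 0 <= s by exact: Ts.
have sL : s <= L by apply: ge_sup; [exists 0|move=> t [] /andP[]].
have [e e0 he] := star_nbhs dist_induced (c s).
have Tsup : has_sup T by split=> //; exists 0.
have Ts' : min_sliced p (c s).
  have [t [/andP[t0 tL] Tt] st] := sup_adherent e0 Tsup; rewrite -/s in st.
  have ts : t <= s by apply: Ts; split=> //; rewrite t0.
  have [|c' [x0 [x [? ? ? ?]]]] := he (c t).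
    by rewrite cc ?s0 ?t0 // ger0_norm ?subr_ge0 //; lra.
  by apply: (step t); rewrite ?t0 //; exists c', x, x0.
pose t := Num.min L (s + e / 2).
have st : s <= t by rewrite le_min sL; lra.
have tL : t <= L by rewrite ge_min lexx.
have te : t <= s + e / 2 by rewrite ge_min lexx orbT.
have Tt : T t.
  split; first by rewrite (le_trans s0 st).
  apply: (step s); rewrite ?s0 //; apply: he.
  by rewrite cc ?s0 ?sL ?(le_trans s0 st) // ler0_norm ?subr_le0 //; lra.
have := Ts _ Tt; rewrite /t ge_min => /orP[Ls|]; last by lra.
by move: Ts'; rewrite (_ : s = L) ?cL //; apply/eqP; rewrite eq_le sL.
Qed.

End Slices.

(** * Minima and zeros of Lipschitz functions on an interval *)

Section LipschitzFunctions.
Variables (R : realType) (f : R -> R) (a b C : R).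
Hypotheses (ab : a <= b) (C0 : 0 < C).
Hypothesis f_lip : forall s t, a <= s <= b -> a <= t <= b -> `|f s - f t| <= C * `|s - t|.

(** Precomposition with [clamp] turns [f], controlled on the interval only, into a function
    continuous on the whole line. *)
Let clamp t := Num.max a (Num.min b t).

Let clamp_in t : a <= clamp t <= b.
Proof. by rewrite /clamp le_max lexx ge_max ab ge_min lexx. Qed.

Let clamp_id t : a <= t <= b -> clamp t = t.
Proof. by move=> /andP[ta tb]; rewrite /clamp (min_idPr tb) (max_idPr ta). Qed.

Let clamp_lip s t : `|clamp s - clamp t| <= `|s - t|.
Proof.
have maxL u v : `|Num.max a u - Num.max a v| <= `|u - v|.
  case: (leP a u) => ?; case: (leP a v) => ?; rewrite ler_norml; apply/andP; split;
  case: (ger0P (u - v)) => ?; lra.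
have minL u v : `|Num.min b u - Num.min b v| <= `|u - v|.
  case: (leP b u) => ?; case: (leP b v) => ?; rewrite ler_norml; apply/andP; split;
  case: (ger0P (u - v)) => ?; lra.
exact: le_trans (maxL _ _) (minL _ _).
Qed.

Let f_clamp_continuous : continuous (f \o clamp).
Proof.
move=> x; apply/cvgrPdist_lt => e e0; near=> t.
apply: le_lt_trans (f_lip (clamp_in _) (clamp_in _)) _.
apply: le_lt_trans (ler_wpM2l (ltW C0) (clamp_lip _ _)) _.
rewrite -ltr_pdivlMl // mulrC; near: t.
by apply: (@cvgr_dist_lt _ _ _ _ _ id x) => //; rewrite divr_gt0.
Unshelve. all: by end_near. Qed.

Lemma lipschitz_min : exists2 s, a <= s <= b & forall t, a <= t <= b -> f s <= f t.
Proof.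
have [s] := EVT_min ab (continuous_subspaceT f_clamp_continuous).
rewrite in_itv /= => sab smin; exists s => // t tab.
by have := smin t; rewrite in_itv /= !clamp_id // => /(_ tab).
Qed.

Lemma lipschitz_zero : f a <= 0 -> 0 <= f b -> exists2 s, a <= s <= b & f s = 0.
Proof.
move=> fa fb.
have [|s] := @IVT _ _ _ _ 0 ab (continuous_subspaceT f_clamp_continuous).
  by rewrite /= !clamp_id ?lexx ?ab // ge_min le_max fa fb orbT.
by rewrite in_itv /= => sab fs; exists s => //; rewrite clamp_id in fs.
Qed.

End LipschitzFunctions.

(** * Distances from a vertex to the points of an edge *)

Section Walls.
Variables (R : realType) (X : metricType R) (K : cube_complex R X).
Hypothesis dist_induced : forall p q : X, induced_dist K p q = (mdist p q)%:E.
Hypothesis HX : CAT0 X.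
Local Notation d := (@mdist R X).
Let iso := chart_isometry dist_induced HX.

Lemma mdist_lip p q r : `|d p q - d p r| <= d q r.
Proof.
rewrite ler_norml; have := metric_triangle p q r; have := metric_triangle p r q.
by rewrite (metric_sym r q) => ? ?; apply/andP; split; lra.
Qed.

Lemma vertex_corner c (x : 'rV[R]_(dim K c)) : cube x -> is_vertex K (chart x) -> corner x.
Proof.
move=> cx [c' [a [ac ax]]]; have ca := corner_cube ac.
have [h [_ _ <- hc _]] := chart_gluing ca cx ax.
by apply: hc => //; exact: cube_suppxx.
Qed.

Lemma corner_vertex c (x : 'rV[R]_(dim K c)) : corner x -> is_vertex K (chart x).
Proof. by move=> xc; exists c, x. Qed.

Lemma line_min q c (x : 'rV[R]_(dim K c)) i : cube x -> exists2 s, `|s| <= 2^-1 &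
  forall t, `|t| <= 2^-1 -> d q (chart (upd x i s)) <= d q (chart (upd x i t)).
Proof.
move=> cx; have [||s s2 smin] := @lipschitz_min R (fun s => d q (chart (upd x i s)))
    (- 2^-1) 2^-1 1 _ ltr01.
- by rewrite -subr_ge0 opprK addr_ge0 ?invr_ge0.
- by move=> s t; rewrite -!ler_norml mul1r => s2 t2; rewrite -(ed_upd x i s t) -iso;
    [exact: mdist_lip|exact: cube_upd|exact: cube_upd].
by exists s => [|t t2]; [rewrite ler_norml|apply: smin; rewrite -ler_norml].
Qed.

(** Otherwise [sliced_endpoint], with the relation that always holds, would give [p] a free
    coordinate, whereas a vertex is a corner in every chart. *)
Lemma vertex_not_min p c (x : 'rV[R]_(dim K c)) i : is_vertex K p -> cube x ->
  `|x 0 i| < 2^-1 -> exists2 s, `|s| <= 2^-1 & d p (chart (upd x i s)) < d p (chart x).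
Proof.
move=> vp cx xi; apply: contrapT => nex.
have trivially : parallel_closed K (fun _ _ => True) by [].
have [|c' [y [j [cy yp yj _]]]] := @sliced_endpoint _ _ K dist_induced HX (fun _ _ => True) trivially p (chart x).
  exists c, x, i; split=> // s s2; rewrite leNgt; apply/negP => lt; apply: nex.
    by exists s => //; rewrite !(metric_sym p).
by move: vp; rewrite -yp => /(vertex_corner cy)/(_ j) E; rewrite E ltxx in yj.
Qed.

Lemma line_min_end s (x : R) : `|x| = 2^-1 -> `|s| = 2^-1 -> s = x \/ s = - x.
Proof. by move=> <- /eqP; rewrite eqr_norm2 => /orP[]/eqP ->; [left|right]. Qed.

(** The midpoint inequality makes the middle of the line strictly closer than its two equidistant
    ends, so the minimum is interior. *)
Lemma tie_min q c (x : 'rV[R]_(dim K c)) i : cube x -> `|x 0 i| = 2^-1 ->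
  d q (chart x) = d q (chart (flip x i)) -> exists2 s, `|s| < 2^-1 &
  forall t, `|t| <= 2^-1 -> d q (chart (upd x i s)) <= d q (chart (upd x i t)).
Proof.
move=> cx xi tie; have [s s2 smin] := line_min q i cx.
exists s => //; rewrite lt_neqAle s2 andbT; apply/eqP => sE.
have cfx : cube (flip x i) by apply: cube_upd => //; rewrite normrN xi.
have z2 : `|0 : R| <= 2^-1 by rewrite normr0 invr_ge0.
have dmin : d q (chart x) <= d q (chart (upd x i 0)).
  have := smin 0 z2; have [->|->] := line_min_end xi sE; first by rewrite updE.
  by rewrite tie.
have cz : cube (upd x i 0) by exact: cube_upd.
have h1 : d (chart x) (chart (upd x i 0)) = 2^-1.
  by rewrite iso // -{1}[x](updE _ i) ed_upd subr0.
have h2 : d (chart (upd x i 0)) (chart (flip x i)) = 2^-1.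
  by rewrite iso // ed_upd sub0r opprK.
have h3 : d (chart x) (chart (flip x i)) = 2 * 2^-1.
  by rewrite iso // -{1}[x](updE _ i) ed_upd opprK -mulr2n normrMn xi mulr_natl.
have := CAT0_midpoint HX q h1 h2 h3; rewrite -tie.
have : d q (chart x) ^+ 2 <= d q (chart (upd x i 0)) ^+ 2.
  by rewrite ler_pXn2r ?nnegrE ?mdist_ge0.
have : 0 < (2^-1 : R) ^+ 2 by rewrite exprn_gt0 ?invr_gt0.
lra.
Qed.

(** The point [x] may be any point of the facet, not just a corner, so that [halfspace_parallel] can
    move it continuously. *)
Lemma vertex_no_tie p c (x : 'rV[R]_(dim K c)) i : is_vertex K p -> cube x ->
  `|x 0 i| = 2^-1 -> d p (chart x) <> d p (chart (flip x i)).
Proof.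
move=> vp cx xi /(tie_min cx xi)[s s2 smin].
have cxs : cube (upd x i s) by apply: cube_upd => //; exact: ltW.
have [|t t2] := @vertex_not_min p c (upd x i s) i vp cxs; first by rewrite upd_same.
by rewrite upd_upd ltNge smin.
Qed.

Lemma vertex_line_min p c (a : 'rV[R]_(dim K c)) i s : is_vertex K p -> corner a ->
  d p (chart (flip a i)) < d p (chart a) -> `|s| <= 2^-1 ->
  d p (chart (flip a i)) <= d p (chart (upd a i s)).
Proof.
move=> vp ac lt s2; have ca := corner_cube ac; have [t t2 tmin] := line_min p i ca.
have [tlt|tge] := ltP `|t| 2^-1.
  have [||u u2] := @vertex_not_min p c (upd a i t) i vp; rewrite ?upd_same //.
    exact: cube_upd.
  by rewrite upd_upd ltNge tmin.
have {}t2 : `|t| = 2^-1 by apply/eqP; rewrite eq_le t2.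
have := tmin s s2; have [->|->//] := line_min_end (ac i) t2; rewrite updE => le.
exact: le_trans (ltW lt) le.
Qed.

Lemma line_descend p c (a : 'rV[R]_(dim K c)) i s : is_vertex K p -> corner a ->
  `|s| <= 2^-1 -> d p (chart (upd a i s)) < d p (chart a) ->
  d p (chart (flip a i)) < d p (chart a).
Proof.
move=> vp ac s2 lt; rewrite ltNge le_eqVlt; apply/negP => /orP[/eqP|lt'].
  by apply: vertex_no_tie => //; exact: corner_cube.
have := @vertex_line_min p c (flip a i) i s vp (corner_flip i ac).
by rewrite flipK {2}/flip upd_upd => /(_ lt' s2); rewrite leNgt lt.
Qed.

(** The closer end is the point of the edge nearest to [p], so the angle there is at least right and
    Pythagoras' inequality holds. The drop by 1 drives the later inductions. *)
Lemma edge_descent p c (a : 'rV[R]_(dim K c)) i : is_vertex K p -> corner a ->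
  d p (chart (flip a i)) < d p (chart a) ->
  d p (chart (flip a i)) ^+ 2 + 1 <= d p (chart a) ^+ 2.
Proof.
move=> vp ac lt; have ca := corner_cube ac; have cf := corner_cube (corner_flip i ac).
(* The CN inequality at distance [l] from the closer end, divided by [l], gives the claim up to an
   error [l <= e]. *)
apply/ler_addgt0Pr => e e0; pose l := Num.min 1 e.
have l0 : 0 < l by rewrite lt_min ltr01.
have l1 : l <= 1 by rewrite ge_min lexx.
have le : l <= e by rewrite ge_min lexx orbT.
have l01 : 0 <= l <= 1 by rewrite ltW.
pose m := (1 - l) *: flip a i + l *: a.
have cm : cube m by exact: cube_lerp.
have mE : m = upd a i ((1 - l) * - a 0 i + l * a 0 i).
  by rewrite -lerp_upd updE.
have := @CAT0_cn _ _ HX p (chart (flip a i)) (chart a) (chart m) l l01.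
rewrite !iso // ed_lerpl ?(ltW l0) // ed_lerpr // edC ed_flip // => /(_ erefl erefl).
have : d p (chart (flip a i)) ^+ 2 <= d p (chart m) ^+ 2.
  rewrite ler_pXn2r ?nnegrE ?mdist_ge0 // mE; apply: vertex_line_min => //.
  by rewrite -(upd_same a i (_ + _)) -mE.
rewrite expr1n mulr1 => le1 le2.
have : 0 <= l * (d p (chart a) ^+ 2 - d p (chart (flip a i)) ^+ 2 - 1 + l) by lra.
by rewrite pmulr_rge0 //; lra.
Qed.

End Walls.

(** * Edges, halfspaces and the walls they define *)

Section Halfspaces.
Variables (R : realType) (X : metricType R) (K : cube_complex R X).
Hypothesis dist_induced : forall p q : X, induced_dist K p q = (mdist p q)%:E.
Hypothesis HX : CAT0 X.
Local Notation d := (@mdist R X).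
Let iso := chart_isometry dist_induced HX.

Definition edge u v := [/\ is_vertex K u, is_vertex K v & d u v = 1].

Definition halfspace u v : set X := [set p | is_vertex K p /\ d p u < d p v].

Lemma edge_sym u v : edge u v -> edge v u.
Proof. by move=> [? ? uv]; split; rewrite // metric_sym. Qed.

Lemma edge_flip c (a : 'rV[R]_(dim K c)) i : corner a -> edge (chart a) (chart (flip a i)).
Proof.
move=> ac; have fc := corner_flip i ac.
by split; [exact: corner_vertex|exact: corner_vertex|rewrite iso ?ed_flip //; exact: corner_cube].
Qed.

Lemma halfspace_l u v : edge u v -> halfspace u v u.
Proof. by move=> [vu _ uv]; split; rewrite // mdistxx uv. Qed.

Lemma halfspace_r u v : edge u v -> ~ halfspace u v v.
Proof. by move=> [_ _ uv] []; rewrite mdistxx metric_sym uv ltNge ler01. Qed.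

Lemma halfspace_disjoint u v p : halfspace u v p -> ~ halfspace v u p.
Proof. by move=> [_ uv] [_]; rewrite ltNge (ltW uv). Qed.

(** The geodesic from [a] to [q] starts inside a cube and changes some coordinate [i]; sliding the
    corner to the new value of that coordinate already brings it closer to [q]. *)
Lemma descent a q : is_vertex K a -> is_vertex K q -> a <> q ->
  exists c (x : 'rV[R]_(dim K c)) i,
    [/\ corner x, chart x = a & d q (chart (flip x i)) < d q a].
Proof.
move=> va vq aq; have [geo _] := HX; have [g [g0 gL gg]] := geo a q.
set L := d a q in gL gg; have L0 : 0 < L by rewrite mdist_gt0; exact/eqP.
have [e e0 he] := star_nbhs dist_induced a.
pose t := Num.min L (e / 2).
have t0 : 0 < t by rewrite lt_min L0 divr_gt0.
have tL : t <= L by rewrite ge_min lexx.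
have te : t <= e / 2 by rewrite ge_min lexx orbT.
have at_ : d a (g t) = t.
  by rewrite -g0 gg ?lexx ?(ltW L0) ?(ltW t0) // sub0r normrN gtr0_norm.
have tq : d (g t) q = L - t.
  by rewrite -gL gg ?lexx ?(ltW L0) ?(ltW t0) // ler0_norm ?subr_le0 // opprB.
have [|c [x0 [x [cx0 cx x0a xt]]]] := he (g t); first by rewrite at_; lra.
have xc : corner x0 by apply: (vertex_corner cx0); rewrite x0a.
have [i xi] : exists i, x 0 i != x0 0 i.
  apply/existsP; rewrite -negb_forall; apply/negP => /forallP E.
  have xx0 : x = x0 by apply/rowP => i; apply/eqP; exact: E.
  by move: at_ t0; rewrite -xt xx0 x0a mdistxx => <-; rewrite ltxx.
exists c, x0, i; split=> //; rewrite -x0a; apply: (line_descend dist_induced HX vq xc (cx i)).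
have cu : cube (upd x0 i (x 0 i)) by apply: cube_upd.
have lt : ed (upd x0 i (x 0 i)) x < ed x0 x.
  rewrite -(ltr_pXn2r (n := 2)) ?nnegrE ?ed_ge0 //.
  rewrite -[X in ed (upd _ _ _) X](updE x i) ed_upd2 subrr expr0n addr0 ltrBlDr ltrDl.
  by rewrite exprn_even_gt0 //= subr_eq0 eq_sym.
have := metric_triangle q (g t) (chart (upd x0 i (x 0 i))).
move: lt; rewrite -!iso // x0a xt at_ (metric_sym q (g t)) tq (metric_sym (g t)).
by rewrite (metric_sym q a) -/L; lra.
Qed.

Lemma edge_descends a q : is_vertex K a -> is_vertex K q -> a <> q ->
  exists b, [/\ edge a b, d q b < d q a & d q b ^+ 2 + 1 <= d q a ^+ 2].
Proof.
move=> va vq aq; have [c [x [i [xc <- lt]]]] := descent va vq aq.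
by exists (chart (flip x i)); split=> //; [exact: edge_flip|exact: edge_descent].
Qed.

Lemma vertex_separated a b : is_vertex K a -> is_vertex K b -> a <> b -> 1 <= d a b.
Proof.
move=> va vb ab; have [b' [_ _ le]] := edge_descends va vb ab.
rewrite metric_sym -(ler_pXn2r (n := 2)) ?nnegrE ?mdist_ge0 // expr1n.
by have := sqr_ge0 (d b b'); lra.
Qed.

(** A step from [u] towards [v] lowers the squared distance 1 by at least 1, so it ends at [v]. *)
Lemma edge_chart u v : edge u v -> exists c (x : 'rV[R]_(dim K c)) i,
  [/\ corner x, chart x = u & chart (flip x i) = v].
Proof.
move=> [vu vv uv]; have nuv : u <> v by move=> E; move: uv (@ltr01 R); rewrite E mdistxx => <-; rewrite ltxx.
have [c [x [i [xc xu lt]]]] := descent vu vv nuv; exists c, x, i; split=> //.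
have := @edge_descent _ _ _ dist_induced HX v _ x i vv xc; rewrite xu => /(_ lt).
rewrite (metric_sym v u) uv expr1n => le.
by apply/esym/mdist_positivity/eqP; rewrite -sqrf_eq0 eq_le sqr_ge0 andbT; lra.
Qed.

Lemma edge_no_tie u v p : edge u v -> is_vertex K p -> d p u <> d p v.
Proof.
move=> /edge_chart[c [x [i [xc <- <-]]]] vp.
by apply: vertex_no_tie => //; exact: corner_cube.
Qed.

Lemma halfspaceN u v p : edge u v -> is_vertex K p -> ~ halfspace u v p -> halfspace v u p.
Proof.
move=> uv vp np; split=> //; rewrite ltNge le_eqVlt; apply/negP => /orP[/eqP|lt].
  exact: edge_no_tie.
by apply: np.
Qed.

Lemma edge_step u v p : edge u v -> halfspace v u p -> d p v ^+ 2 + 1 <= d p u ^+ 2.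
Proof.
move=> /edge_chart[c [x [i [xc <- <-]]]] [vp lt]; exact: edge_descent.
Qed.

(** Move [a] to [b] inside the facet and [flip a i] in parallel. The difference of the distances
    from [p] is continuous and never 0 by [vertex_no_tie], so it keeps its sign. *)
Lemma halfspace_parallel c (a b : 'rV[R]_(dim K c)) i : corner a -> corner b ->
  a 0 i = b 0 i ->
  halfspace (chart a) (chart (flip a i)) = halfspace (chart b) (chart (flip b i)).
Proof.
have key (a' b' : 'rV[R]_(dim K c)) p : corner a' -> corner b' -> a' 0 i = b' 0 i ->
    halfspace (chart a') (chart (flip a' i)) p ->
    halfspace (chart b') (chart (flip b' i)) p.
  move=> ac bc ab [vp lt]; split=> //; rewrite ltNge; apply/negP => ge.
  have [ca cb] := (corner_cube ac, corner_cube bc).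
  have [cfa cfb] := (corner_cube (corner_flip i ac), corner_cube (corner_flip i bc)).
  pose x t := (1 - t) *: a' + t *: b'; pose y t := (1 - t) *: flip a' i + t *: flip b' i.
  have xy t : y t = flip (x t) i.
    by apply/rowP => j; rewrite !mxE; case: eqP => [_|//]; rewrite ab; ring.
  have cx t : 0 <= t <= 1 -> cube (x t) by exact: cube_lerp.
  have cy t : 0 <= t <= 1 -> cube (y t) by exact: cube_lerp.
  pose f t := d p (chart (x t)) - d p (chart (y t)).
  have [||||t t01] := @lipschitz_zero R f 0 1
      (ed a' b' + ed (flip a' i) (flip b' i) + 1) ler01.
  - by have := ed_ge0 a' b'; have := ed_ge0 (flip a' i) (flip b' i); lra.
  - move=> s t s01 t01; rewrite /f.
    have h1 : `|d p (chart (x s)) - d p (chart (x t))| <= `|s - t| * ed a' b'.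
      by rewrite -lerp_sub -(iso (cx s s01) (cx t t01)); exact: mdist_lip.
    have h2 : `|d p (chart (y s)) - d p (chart (y t))| <=
        `|s - t| * ed (flip a' i) (flip b' i).
      by rewrite -lerp_sub -(iso (cy s s01) (cy t t01)); exact: mdist_lip.
    have := ler_normB (d p (chart (x s)) - d p (chart (x t)))
                      (d p (chart (y s)) - d p (chart (y t))).
    rewrite (_ : _ - _ - _ = d p (chart (x s)) - d p (chart (y s)) -
                 (d p (chart (x t)) - d p (chart (y t)))); last by ring.
    by have := normr_ge0 (s - t); lra.
  - by rewrite /f /x /y !subr0 !scale1r !scale0r !addr0 subr_le0 ltW.
  - by rewrite /f /x /y !subrr !scale1r !scale0r !add0r subr_ge0.
  move/eqP; rewrite subr_eq0 xy => /eqP.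
  apply: vertex_no_tie => //; first exact: cx.
  by rewrite !mxE -ab -mulrDl subrK mul1r.
by move=> ac bc ab; apply/seteqP; split=> p; apply: key.
Qed.

Lemma halfspace_swap u v a b : edge u v -> edge a b ->
  halfspace a b = halfspace u v -> halfspace b a = halfspace v u.
Proof.
have key u' v' a' b' : edge a' b' -> edge u' v' -> halfspace a' b' = halfspace u' v' ->
    halfspace b' a' `<=` halfspace v' u'.
  move=> ab uv E p pba; have [vp _] := pba; apply: halfspaceN => //; rewrite -E.
  by move=> pab; exact: halfspace_disjoint pba pab.
by move=> uv ab E; apply/seteqP; split; apply: key.
Qed.

(** Both orientations are allowed because [direction] ranges over the corners at both ends of the
    edges. *)
Definition same_wall u v a b :=
  edge a b /\ (halfspace a b = halfspace u v \/ halfspace a b = halfspace v u).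

Lemma same_wall_closed u v : edge u v -> parallel_closed K (same_wall u v).
Proof.
move=> uv c a b i ac bc [_ W]; split; first exact: edge_flip.
have [E|E] := line_min_end (bc i) (ac i).
  by rewrite -(halfspace_parallel ac bc E).
have <- : halfspace (chart (flip a i)) (chart a) = halfspace (chart b) (chart (flip b i)).
  have := @halfspace_parallel c (flip a i) b i (corner_flip i ac) bc; rewrite flipK.
  by apply; rewrite upd_same E opprK.
by case: W => W; [right|left]; apply: halfspace_swap W => //;
   [exact: edge_flip|exact: edge_sym|exact: edge_flip].
Qed.

Lemma sliced_same_wall u v q c (x : 'rV[R]_(dim K c)) : edge u v ->
  sliced K (same_wall u v) q -> cube x -> chart x = q ->
  exists2 i, `|x 0 i| < 2^-1 & direction (same_wall u v) i.
Proof.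
move=> uv [c' [y [j [cy yq yj dir]]]] cx xq.
have [|i [e [_ xi dx _]]] := direction_transfer (same_wall_closed uv) cy cx _ yj dir.
  by rewrite yq.
by exists i.
Qed.

Lemma sliced_line u v q c (x : 'rV[R]_(dim K c)) i s : edge u v -> corner x ->
  chart x = u -> chart (flip x i) = v -> `|s| < 2^-1 ->
  (forall t, `|t| <= 2^-1 -> d q (chart (upd x i s)) <= d q (chart (upd x i t))) ->
  sliced K (same_wall u v) q.
Proof.
move=> uv xc xu xv s2 smin; have cx := corner_cube xc.
apply: (@sliced_endpoint _ _ _ dist_induced HX _ (same_wall_closed uv) q (chart (upd x i s))).
exists c, (upd x i s), i; split=> //.
- exact: cube_upd (ltW s2).
- by rewrite upd_same.
- by move=> a ac; apply: (same_wall_closed uv xc ac); rewrite xu xv; split=> //; left.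
- by move=> t t2; rewrite upd_upd !(metric_sym _ q); exact: smin.
Qed.

Lemma tie_sliced u v q : edge u v -> d q u = d q v -> sliced K (same_wall u v) q.
Proof.
move=> uv /= tie; have [c [x [i [xc xu xv]]]] := edge_chart uv.
have cx := corner_cube xc; rewrite -xu -xv in tie.
have [s s2 smin] := tie_min dist_induced HX cx (xc i) tie.
exact: sliced_line smin.
Qed.

(** Some point of the edge from [a] to [b] is equidistant from [u] and [v]. By [tie_sliced] the wall
    of [u], [v] has a free direction there, and a point of an edge has no free direction but the
    edge. *)
Lemma halfspace_crossing u v a b : edge u v -> edge a b ->
  halfspace u v a -> halfspace v u b -> halfspace a b = halfspace u v.
Proof.
move=> uv ab au bv; have [c [x [i [xc xa xb]]]] := edge_chart ab.
have [cx cfx] := (corner_cube xc, corner_cube (corner_flip i xc)).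
pose m t := (1 - t) *: x + t *: flip x i.
have cm t : 0 <= t <= 1 -> cube (m t) by exact: cube_lerp.
pose f t := d (chart (m t)) u - d (chart (m t)) v.
have [||||t t01] := @lipschitz_zero R f 0 1 2 ler01.
- by [].
- move=> s t s01 t01; rewrite /f.
  have h w : `|d (chart (m s)) w - d (chart (m t)) w| <= `|s - t|.
    have -> : `|s - t| = `|s - t| * ed x (flip x i) by rewrite ed_flip // mulr1.
    rewrite !(metric_sym _ w) -lerp_sub.
    by rewrite -(iso (cm s s01) (cm t t01)); exact: mdist_lip.
  have := h u; have := h v.
  have := ler_normB (d (chart (m s)) u - d (chart (m t)) u)
                    (d (chart (m s)) v - d (chart (m t)) v).
  rewrite (_ : _ - _ - _ = d (chart (m s)) u - d (chart (m s)) v -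
               (d (chart (m t)) u - d (chart (m t)) v)); last by ring.
  lra.
- by rewrite /f /m subr0 scale1r scale0r addr0 xa subr_le0; case: au => _ /ltW.
- by rewrite /f /m subrr scale1r scale0r add0r xb subr_ge0; case: bv => _ /ltW.
move/eqP; rewrite subr_eq0 => /eqP /(tie_sliced uv) sl.
have [j mj dir] := sliced_same_wall uv sl (cm _ t01) erefl.
have ji : j = i.
  apply/eqP/negPn/negP => ji; move: mj; rewrite !mxE (negbTE ji) -mulrDl subrK mul1r.
  by rewrite xc ltxx.
have [_] := dir _ xc; rewrite ji xa xb => -[//|E].
have : halfspace a b a by exact: halfspace_l.
by rewrite E => /halfspace_disjoint; case.
Qed.

(** The cube is one containing the start of the geodesic from [a] to [p]. An edge towards [p] makes
    an acute angle with the geodesic, so a nearby point [g t] projects to the interior of that edge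
    and lies in a slice of its wall. *)
Lemma closer_edges_in_cube a p : is_vertex K a -> is_vertex K p ->
  exists c (x : 'rV[R]_(dim K c)), [/\ corner x, chart x = a &
    forall b, edge a b -> halfspace b a p -> exists i, b = chart (flip x i)].
Proof.
move=> va vp; have [/eqP ap|/eqP nap] := boolP (a == p).
  have [c [x [xc xa]]] := va; exists c, x; split=> // b ab [_].
  by rewrite -ap mdistxx ltNge mdist_ge0.
have [geo _] := HX; have [g [g0 gL gg]] := geo a p.
set L := d a p in gL gg; have L1 : 1 <= L by exact: vertex_separated.
have [e e0 he] := star_nbhs dist_induced a.
(* The bound [4^-1] makes [b] farther from [g t] than [a] is. *)
pose t := Num.min 4^-1 (e / 2).
have t0 : 0 < t by rewrite lt_min invr_gt0 ltr0n divr_gt0.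
have t4 : t <= 4^-1 by rewrite ge_min lexx.
have te : t <= e / 2 by rewrite ge_min lexx orbT.
have at_ : d a (g t) = t.
  by rewrite -g0 gg ?lexx ?(ltW t0) //=; [rewrite sub0r normrN gtr0_norm|lra|lra].
have tp : d (g t) p = L - t.
  by rewrite -gL gg ?lexx ?(ltW t0) //=; [rewrite ler0_norm ?opprB //|..]; lra.
have [|c [x0 [x [cx0 cx x0a xt]]]] := he (g t); first by rewrite at_; lra.
have xc : corner x0 by apply: (vertex_corner cx0); rewrite x0a.
exists c, x0; split=> // b ab bp; have [c' [y [j [yc ya yb]]]] := edge_chart ab.
have [cy cfy] := (corner_cube yc, corner_cube (corner_flip j yc)).
pose l := t / L; have l0 : 0 < l by rewrite divr_gt0 //; lra.
have l1 : l <= 1 by rewrite ler_pdivrMr ?mul1r; lra.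
have l01 : 0 <= l <= 1 by rewrite l1 ltW.
have lL : l * L = t by rewrite /l divfK //; apply/eqP; lra.
pose m := (1 - l) *: y + l *: flip y j.
have cm : cube m by exact: cube_lerp.
have am : d a (chart m) = l by rewrite -ya iso // ed_lerpl ?ltW // ed_flip // mulr1.
have mb : d (chart m) b = 1 - l by rewrite -yb iso // ed_lerpr // ed_flip // mulr1.
have [_ _ ab1] := ab.
have pm : d p (chart m) ^+ 2 <= L ^+ 2 - 2 * l + l ^+ 2.
  have := @CAT0_cn _ _ HX p a b (chart m) l l01; rewrite am mb ab1 !mulr1.
  move=> /(_ erefl erefl); have := edge_step ab bp; rewrite (metric_sym p a) -/L expr1n.
  by have := mulr_ge0 (ltW l0) (ltW l0); nra.
(* The two CN inequalities bound the left side by [t ^+ 2 - l ^+ 2]. *)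
have gm : d (g t) (chart m) ^+ 2 < t ^+ 2.
  have := @CAT0_cn _ _ HX (chart m) a p (g t) l l01; rewrite -/L at_ tp lL.
  rewrite mulrBl mul1r lL => /(_ erefl erefl).
  rewrite (metric_sym _ a) am (metric_sym _ p) (metric_sym _ (g t)) => le.
  apply: le_lt_trans le _.
  have : l * d p (chart m) ^+ 2 <= l * (L ^+ 2 - 2 * l + l ^+ 2).
    by apply: ler_wpM2l pm; exact: ltW.
  have : 0 < l ^+ 2 by rewrite exprn_gt0.
  by rewrite -lL; nra.
have {}gm : d (g t) (chart m) < t.
  by rewrite -(ltr_pXn2r (n := 2)) ?nnegrE ?mdist_ge0 ?ltW.
have gb : t < d (g t) b.
  by have := metric_triangle a (g t) b; rewrite at_ ab1; lra.
have [s s2 smin] := line_min dist_induced HX (g t) j cy.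
have mE : m = upd y j ((1 - l) * y 0 j + l * - y 0 j) by rewrite -lerp_upd updE.
have gs : d (g t) (chart (upd y j s)) < t.
  apply: le_lt_trans gm; rewrite mE; apply: smin.
  by rewrite -(upd_same y j (_ + _)) -mE; exact: cm.
have {}s2 : `|s| < 2^-1.
  rewrite lt_neqAle s2 andbT; apply/eqP => sE; move: gs.
  have [->|->] := line_min_end (yc j) sE.
    by rewrite updE ya metric_sym at_ ltxx.
  by rewrite yb ltNge ltW.
have [i _ dir] := sliced_same_wall ab (sliced_line ab yc ya yb s2 smin) cx xt.
have ef := edge_flip i xc; rewrite x0a in ef.
have [_] := dir _ xc; rewrite x0a => -[E|E]; last first.
  by have := halfspace_l ef; rewrite E => /halfspace_disjoint; case; exact: halfspace_l.
exists i; apply: contrapT => nbx; have [_ vb _] := ab; have [_ vf _] := ef.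
have : ~ halfspace a (chart (flip x0 i)) b by rewrite E; exact: halfspace_r.
move=> /(halfspaceN ef vb)[_]; rewrite (metric_sym b a) ab1.
by rewrite ltNge vertex_separated.
Qed.

End Halfspaces.

(** * Medians and the growth of intervals *)

Section Combinatorics.
Variables (R : realType) (X : metricType R) (K : cube_complex R X).
Hypothesis dist_induced : forall p q : X, induced_dist K p q = (mdist p q)%:E.
Hypothesis HX : CAT0 X.
Local Notation d := (@mdist R X).
Local Notation edge := (edge K).
Local Notation halfspace := (halfspace K).
Local Notation vertex := (is_vertex K).
Implicit Types (H L : set X) (a b u v x y z m p : X).

Definition is_halfspace H := exists u v, edge u v /\ H = halfspace u v.

Lemma halfspace_is u v : edge u v -> is_halfspace (halfspace u v).
Proof. by move=> uv; exists u, v. Qed.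

Lemma crossing_edge H a b : is_halfspace H -> edge a b -> H a -> ~ H b ->
  H = halfspace a b.
Proof.
move=> [u [v [uv ->]]] ab Ha nHb; apply/esym.
have [_ vb _] := ab.
apply: (halfspace_crossing dist_induced HX uv ab Ha).
exact: (halfspaceN dist_induced HX uv vb nHb).
Qed.

(** Both edges lead towards [p], so they span a square of one cube, and [b'] is its fourth
    corner. *)
Lemma square_parallel a b a' p : edge a b -> edge a a' -> b <> a' ->
  halfspace b a p -> halfspace a' a p ->
  exists2 b', edge a' b' & halfspace b' a' = halfspace b a.
Proof.
move=> ab aa' nba' pb pa'; have [va _ _] := ab; have [vp _] := pb.
have [c [x [xc xa cl]]] := closer_edges_in_cube dist_induced HX va vp.
have [i bi] := cl _ ab pb; have [j a'j] := cl _ aa' pa'.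
have ij : i != j by apply/eqP => ij; apply: nba'; rewrite bi a'j ij.
have jc := corner_flip j xc.
have e' := edge_flip dist_induced HX i jc; rewrite -a'j in e'.
exists (chart (flip (flip x j) i)) => //.
apply: (halfspace_swap dist_induced HX ab e').
rewrite a'j -xa bi; apply: (halfspace_parallel dist_induced HX jc xc).
by rewrite /flip upd_other.
Qed.

(** Let [a'] be a neighbour of [a] closer to [v]. If the halfspaces of [b] and [a'] meet, a square
    moves the wall to an edge at [a']; if not, the halfspace lies in [halfspace a a']. Either way
    the base is closer to [v]. *)
Lemma adjacent_halfspace v a b : vertex v -> edge b a -> ~ halfspace b a v ->
  exists2 b', edge v b' & halfspace b a `<=` halfspace b' v.
Proof.
move=> vv; have [N] : exists N, d v a ^+ 2 < N%:R.
  by exists (Num.bound (d v a ^+ 2)); apply: archi_boundP; exact: sqr_ge0.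
elim: N a b => [|N IH] a b; first by rewrite mulr0n ltNge sqr_ge0 /=.
move=> lt ba nv; have ab := edge_sym ba; have [va vb _] := ab.
have [av|/eqP nav] := eqVneq a v; first by exists b; rewrite -av.
have [a' [aa' lt' le]] := edge_descends dist_induced HX va vv nav.
have {lt}lt : d v a' ^+ 2 < N%:R by rewrite -natr1 in lt; lra.
have va' : halfspace a' a v by split.
have [[p [pb pa']]|none] := pselect (exists p, halfspace b a p /\ halfspace a' a p).
  have nba' : b <> a' by move=> E; apply: nv; rewrite E.
  have [b' a'b' E] := square_parallel ab aa' nba' pb pa'.
  by rewrite -E; apply: IH => //; [exact: edge_sym|rewrite E].
have sub : halfspace b a `<=` halfspace a a'.
  move=> p pb; have [vp _] := pb; apply: (halfspaceN dist_induced HX (edge_sym aa') vp).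
  by move=> pa'; apply: none; exists p.
have [b' vb' sub'] := IH a' a lt aa' (halfspace_disjoint va').
by exists b' => //; exact: subset_trans sub sub'.
Qed.

Definition separating x y := [set H | [/\ is_halfspace H, ~ H x & H y]].

(** A list that may repeat or exceed [D]: only an upper bound on the number of elements is
    wanted. *)
Definition covers (s : seq (set X)) (D : set (set X)) := forall H, D H -> H \in s.

(** Each step of a descending path crosses one wall and lowers the squared distance by at least
    1. *)
Lemma separating_cover x y : vertex x -> vertex y ->
  exists2 s, covers s (separating x y) & (size s)%:R <= d x y ^+ 2.
Proof.
move=> vx; have [N] : exists N, d x y ^+ 2 < N%:R.
  by exists (Num.bound (d x y ^+ 2)); apply: archi_boundP; exact: sqr_ge0.
elim: N y => [|N IH] y; first by rewrite mulr0n ltNge sqr_ge0 /=.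
move=> lt vy; have [->|/eqP nyx] := eqVneq y x.
  by exists [::]; [move=> H []|rewrite sqr_ge0].
have [b [yb _ le]] := edge_descends dist_induced HX vy vx nyx.
have [_ vb _] := yb.
have [|s cs sz] := IH b _ vb; first by rewrite -natr1 in lt; lra.
exists (halfspace y b :: s); last by rewrite /= -natr1; lra.
move=> H [hH nx Hy]; rewrite inE; have [Hb|nHb] := pselect (H b).
  by rewrite cs ?orbT.
by rewrite (crossing_edge hH yb Hy nHb) eqxx.
Qed.

(** Each edge of a descending path from [m] to [x] has length 1 and uses up one halfspace of the
    list. *)
Lemma dist_le_cover x m s : vertex x -> vertex m -> covers s (separating x m) ->
  d x m <= (size s)%:R.
Proof.
move=> vx; elim: {s}(size s) {-2}s (erefl (size s)) m => [|N IH] s sz m vm cs;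
    have [->|/eqP nmx] := eqVneq m x; rewrite ?mdistxx //;
    have [b [mb lt _]] := edge_descends dist_induced HX vm vx nmx;
    have [_ vb mb1] := mb; have hx : halfspace b m x by [];
    have hs : halfspace m b \in s by
      apply: cs; split; [exact: halfspace_is|exact: halfspace_disjoint|exact: halfspace_l].
  by case: s sz hs {cs}.
have szr : size (rem (halfspace m b) s) = N by rewrite size_rem // sz.
have := IH _ szr b vb; rewrite ?szr ?sz -natr1 => le.
have tri : d x m <= d x b + 1 by rewrite -mb1 (metric_sym m) metric_triangle.
suff cb : covers (rem (halfspace m b) s) (separating x b) by have := le cb; lra.
move=> H [hH nHx Hb]; have Hm : H m.
  apply: contrapT => nHm; apply: nHx.
  by rewrite (crossing_edge hH (edge_sym mb) Hb nHm).
apply: rem_mem; last by apply: cs.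
by apply/eqP => E; apply: (halfspace_r mb); rewrite -E.
Qed.

(* [P] singles out at most one side of every wall; walking across adjacent
   walls from [x] leads to a vertex that lies on all these sides. *)
Lemma walk_to (P : set (set X)) x s : vertex x ->
  (forall H H', is_halfspace H -> is_halfspace H' -> H `<=` H' -> P H -> P H') ->
  (forall u v, edge u v -> P (halfspace u v) -> P (halfspace v u) -> False) ->
  covers s [set H | [/\ is_halfspace H, P H & ~ H x]] ->
  exists m, [/\ vertex m, forall H, is_halfspace H -> P H -> H m &
    forall H, is_halfspace H -> H m -> ~ H x -> P H].
Proof.
move=> vx up cons cs.
(* Invariant: the walk has entered only halfspaces of [P]. Each step removes from the list one
   halfspace still to be entered. *)
pose Q v := forall H, is_halfspace H -> H v -> ~ H x -> P H.
suff gen N : forall s v, size s = N -> vertex v -> Q v ->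
    covers s [set H | [/\ is_halfspace H, P H & ~ H v]] ->
    exists m, [/\ vertex m, forall H, is_halfspace H -> P H -> H m & Q m].
  by apply: (gen _ s x) => // H _ Hx /(_ Hx).
elim: N => [|N IH] {vx cs}s v sz vv Qv cs.
  exists v; split=> // H hH PH; apply: contrapT => nH.
  have : H \in s by apply: cs.
  by case: s sz {cs}.
have [all|] := pselect (forall H, is_halfspace H -> P H -> H v); first by exists v.
move=> /existsNP[H /not_implyP[hH /not_implyP[PH nHv]]].
have [a [b [ab HE]]] := hH; rewrite HE in nHv.
have [b' vb' sub] := adjacent_halfspace vv ab nHv.
have hb' := halfspace_is (edge_sym vb').
have Pb' : P (halfspace b' v) by apply: up PH; rewrite ?HE //; exact: halfspace_is.
have [_ vtb' _] := vb'.
have in_s : halfspace b' v \in s.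
  by apply: cs; split=> //; exact: (halfspace_r (edge_sym vb')).
apply: (IH (rem (halfspace b' v) s) b') => //; first by rewrite size_rem // sz.
  move=> L hL Lb' nLx; have [Lv|nLv] := pselect (L v); first exact: Qv.
  by rewrite (crossing_edge hL (edge_sym vb') Lb' nLv).
move=> L [hL PL nLb']; have nLv : ~ L v.
  move=> Lv; have LE := crossing_edge hL vb' Lv nLb'.
  by apply: (cons _ _ vb') => //; rewrite -LE.
apply: rem_mem; last by apply: cs.
by apply/eqP => E; apply: nLb'; rewrite E; exact: halfspace_l (edge_sym vb').
Qed.

(** Two opposite sides of a wall cannot both contain two of the three vertices. The sides to be
    reached from [x] contain [y] and [z], so finitely many separate [x] from [y]. *)
Lemma median x y z : vertex x -> vertex y -> vertex z -> exists2 m, vertex m &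
  forall H, is_halfspace H -> [\/ H x /\ H y, H y /\ H z | H x /\ H z] -> H m.
Proof.
move=> vx vy vz; have [s cs _] := separating_cover vx vy.
have [| | |m [vm Pm _]] := @walk_to
    (fun H => [\/ H x /\ H y, H y /\ H z | H x /\ H z]) x s vx.
- move=> H H' _ _ sub [[? ?]|[? ?]|[? ?]]; [constructor 1|constructor 2|constructor 3];
  by split; apply: sub.
- move=> u v uv; have dis p : halfspace u v p -> halfspace v u p -> False.
    exact: halfspace_disjoint.
  by move=> [[p1 p2]|[p1 p2]|[p1 p2]] [[q1 q2]|[q1 q2]|[q1 q2]];
    solve [exact: dis p1 q1|exact: dis p1 q2|exact: dis p2 q1|exact: dis p2 q2].
- by move=> H [hH [[? ?]|[? ?]|[? ?]] nx] //; apply: cs.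
- by exists m.
Qed.

Section Counting.
Variable n : nat.
Hypothesis dim_le : forall c, (dim K c <= n)%N.

(** Walk from [x] into all halfspaces strictly containing a member of [s], and into no others. At
    the vertex [m] reached, each member is bounded by an edge at [m] towards [y], and these edges
    lie in one cube. *)
Lemma antichain_size x y (s : seq (set X)) : vertex x -> vertex y -> uniq s ->
  (forall H, H \in s -> separating x y H) ->
  {in s &, forall H H', H `<=` H' -> H = H'} -> (size s <= n)%N.
Proof.
move=> vx vy us ss anti; have [t ct _] := separating_cover vx vy.
pose P H := exists L, [/\ L \in s, L `<=` H & L <> H].
have sP L : L \in s -> ~ P L.
  by move=> Ls [L' [L's sub]]; apply; exact: anti.
have [| | |m [vm Pm mP]] := @walk_to P x t vx.
- move=> H H' _ _ HH' [L [Ls LH nLH]]; exists L; split=> //; first exact: subset_trans HH'.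
  by move=> E; apply: nLH; apply/seteqP; split=> //; rewrite E.
- move=> u v uv [L [Ls Lu _]] [L' [L's L'v _]].
  have [_ _ Ly] := ss _ Ls; have [_ _ L'y] := ss _ L's.
  exact: halfspace_disjoint (Lu _ Ly) (L'v _ L'y).
- move=> H [hH [L [Ls LH _]] nHx]; apply: ct; split=> //.
  by apply: LH; have [] := ss _ Ls.
have [c [w [wc wm cl]]] := closer_edges_in_cube dist_induced HX vm vy.
apply: leq_trans (dim_le c); rewrite -[X in (_ <= X)%N]card_ord cardE.
rewrite -(size_map (fun i => halfspace (chart (flip w i)) m)).
apply: uniq_leq_size => // L Ls.
have [hL nLx Ly] := ss _ Ls; have nLm : ~ L m by move=> Lm; apply: (sP L) => //; exact: mP.
have [a [b [ab LE]]] := hL; rewrite LE in nLm.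
have [b' mb' sub] := adjacent_halfspace vm ab nLm; rewrite -LE in sub.
have E : L = halfspace b' m.
  apply: contrapT => nE; apply: (halfspace_r (edge_sym mb')).
  by apply: Pm; [exact: halfspace_is (edge_sym mb')|exists L].
have [|i bi] := cl _ mb'; first by rewrite -E.
by apply/mapP; exists i; rewrite ?mem_enum // -bi.
Qed.

(** The combinatorial interval of [x] and [y], as an intersection of halfspaces. *)
Definition between x y m := [/\ vertex m &
  forall H, is_halfspace H -> H x -> H y -> H m].

(** [m] is determined by the halfspaces containing [m] but not [x]. Each of these contains one
    bounded by an edge at [m] towards [x], and there are at most [n] such edges. The bounding ones
    lie below few others, hence in the short list [Q], and their positions in [Q] encode [m]. *)
Lemma count_between x y rho k (ms : seq X) : vertex x -> vertex y -> uniq ms ->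
  rho ^+ 2 < k.+1%:R -> (forall m, m \in ms -> between x y m /\ d x m <= rho) ->
  (size ms <= (n * k).+1 ^ n)%N.
Proof.
move=> vx vy ums rk msP; have [t ct _] := separating_cover vx vy.
pose L := [seq H <- undup t | `[< separating x y H >]].
have uL : uniq L by rewrite filter_uniq // undup_uniq.
have LP H : (H \in L) <-> separating x y H.
  rewrite mem_filter mem_undup; split=> [/andP[/asboolP]//|sH].
  by rewrite ct // andbT; apply/asboolP.
pose above H := [seq H' <- L | `[< H `<=` H' >]].
have aboveP H H' : (H' \in above H) = `[< H `<=` H' >] && (H' \in L).
  by rewrite mem_filter.
pose Q := [seq H <- L | (size (above H) <= k)%N].
(* On one level, an inclusion forces equal sets [above], hence equal halfspaces: a level is an
   antichain. Levels 1 to [k] make up [Q]. *)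
have level j : (size [seq H <- L | size (above H) == j] <= n)%N.
  apply: (@antichain_size x y) => //; first by rewrite filter_uniq.
    by move=> H; rewrite mem_filter => /andP[_ /LP].
  move=> H H'; rewrite mem_filter => /andP[/eqP szH HL].
  rewrite mem_filter => /andP[/eqP szH' HL'] HH'.
  have sub : {subset above H' <= above H}.
    move=> H2; rewrite !aboveP => /andP[/asboolP H'2 ->]; rewrite andbT.
    by apply/asboolP; exact: subset_trans H'2.
  have [_ E] := uniq_min_size (filter_uniq _ uL) sub (eq_leq (etrans szH (esym szH'))).
  have : H \in above H by rewrite aboveP HL andbT; apply/asboolP.
  by rewrite -E aboveP => /andP[/asboolP H'H _]; apply/seteqP.
have szQ : (size Q <= n * k)%N.
  have above_gt0 H : H \in L -> (0 < size (above H))%N.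
    move=> HL; have : H \in above H by rewrite aboveP HL andbT; apply/asboolP.
    by case: (above H).
  rewrite /Q !size_filter; elim: k {rk Q} => [|k IH].
    rewrite muln0 leqn0 -leqn0 leqNgt -has_count; apply/hasPn => H HL.
    by rewrite -ltnNge above_gt0.
  rewrite mulnS addnC; apply: leq_trans (leq_add IH (level k.+1)).
  rewrite size_filter -count_predUI; apply: leq_trans (leq_addr _ _).
  by apply: sub_count => H /=; rewrite leq_eqVlt ltnS orbC.
pose code_of m (f : {ffun 'I_n -> 'I_(n * k).+1}) := forall H, is_halfspace H -> ~ H x ->
  (H m <-> exists2 i, (f i < size Q)%N & nth set0 Q (f i) `<=` H).
have code_ex m : m \in ms -> exists f, code_of m f.
  move=> /msP[[vm xym] xm].
  have [c [w [wc wm cl]]] := closer_edges_in_cube dist_induced HX vm vx.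
  pose nb (i : 'I_(dim K c)) := chart (flip w i) : X.
  have mnb i : edge m (nb i) by rewrite -wm; exact: edge_flip.
  have inQ i : halfspace (nb i) m x -> halfspace m (nb i) \in Q.
    move=> xi; have sx : separating x y (halfspace m (nb i)).
      split; [exact: halfspace_is|exact: halfspace_disjoint|].
      apply: (halfspaceN dist_induced HX (edge_sym (mnb i)) vy) => yi.
      by apply: (halfspace_r (edge_sym (mnb i))); apply: xym => //;
        exact: halfspace_is (edge_sym (mnb i)).
    rewrite mem_filter (LP _).2 // andbT.
    have [s cs szs] := separating_cover vx vm.
    have : (size s < k.+1)%N.
      rewrite -(ltr_nat R); apply: le_lt_trans szs _; apply: le_lt_trans rk.
      by rewrite ler_pXn2r ?nnegrE ?mdist_ge0 // (le_trans (mdist_ge0 x m)).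
    rewrite ltnS; apply: leq_trans; apply: uniq_leq_size; first exact: filter_uniq.
    move=> H; rewrite aboveP => /andP[/asboolP sub /LP[hH nHx _]].
    by apply: cs; split=> //; apply: sub; exact: halfspace_l.
  pose g (i : 'I_n) : nat := if insub (val i) is Some j then
    if `[< halfspace (nb j) m x >] then index (halfspace m (nb j)) Q else size Q
    else size Q.
  have g_lt i : (g i < (n * k).+1)%N.
    rewrite ltnS; apply: leq_trans szQ; rewrite /g.
    by case: insubP => // j _ _; case: asboolP => // _; exact: index_size.
  exists [ffun i => Ordinal (g_lt i)] => H hH nHx; split; last first.
    move=> [i0]; rewrite ffunE /= /g; case: insubP => [j _ _|]; last by rewrite ltnn.
    case: asboolP => [xj lt|]; last by rewrite ltnn.
    by rewrite nth_index ?inQ //; apply; exact: halfspace_l.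
  move=> Hm; have [u [v [uv HE]]] := hH; rewrite HE in Hm nHx *.
  have [b mb sub] := adjacent_halfspace vm (edge_sym uv) (halfspace_disjoint Hm).
  have xb : halfspace b m x by apply: sub; exact: (halfspaceN dist_induced HX uv vx).
  have [j bj] := cl _ mb xb; have jn := leq_trans (ltn_ord j) (dim_le c).
  have gj : g (Ordinal jn) = index (halfspace m b) Q.
    rewrite /g; case: insubP => [j' _ /val_inj ->|/=]; last by rewrite ltn_ord.
    by rewrite /nb -bj; case: asboolP.
  have bQ : halfspace m b \in Q by rewrite bj; apply: inQ; rewrite /nb -bj.
  exists (Ordinal jn); rewrite ffunE /= gj ?index_mem // nth_index // => p pb.
  have [vp _] := pb; apply: contrapT => np.
  apply: (halfspace_disjoint pb); apply: sub.
  exact: (halfspaceN dist_induced HX uv vp np).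
have [|code codeP] := @choice _ _ (fun m f => m \in ms -> code_of m f).
  by move=> m; have [/code_ex[f]|_] := boolP (m \in ms); [exists f|exists [ffun=> ord0]].
rewrite -(size_map code).
have -> : ((n * k).+1 ^ n = #|{: {ffun 'I_n -> 'I_(n * k).+1}}|)%N.
  by rewrite card_ffun !card_ord.
suff ucode : uniq (map code ms) by rewrite -(card_uniqP ucode) max_card.
rewrite map_inj_in_uniq // => m m' mms m'ms E.
have [[vm _] _] := msP _ mms; have [[vm' _] _] := msP _ m'ms.
have same H : is_halfspace H -> ~ H x -> H m <-> H m'.
  by move=> hH nHx; rewrite (codeP _ mms) // (codeP _ m'ms) // E.
have [//|/eqP nmm'] := eqVneq m m'.
(* The wall of an edge from [m] towards [m'] separates them, and the side of it that misses [x]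
   distinguishes their codes. *)
have [b [mb lt _]] := edge_descends dist_induced HX vm vm' nmm'.
have bm' : halfspace b m m' by [].
have [xb|nxb] := pselect (halfspace b m x).
  have [/(_ (halfspace_l mb)) m'b _] :=
    same _ (halfspace_is mb) (halfspace_disjoint xb).
  by have := halfspace_disjoint bm' m'b.
have [_ /(_ bm') mb'] := same _ (halfspace_is (edge_sym mb)) nxb.
by have := halfspace_r (edge_sym mb) mb'.
Qed.

End Counting.

End Combinatorics.

(** * Rapid decay *)

Lemma sum_le_cond (R : realFieldType) (I : eqType) (s : seq I) (P Q : pred I)
    (f : I -> R) : (forall i, i \in s -> P i -> Q i) ->
  (forall i, i \in s -> 0 <= f i) -> \sum_(i <- s | P i) f i <= \sum_(i <- s | Q i) f i.
Proof.
move=> PQ f0; rewrite big_mkcond [leRHS]big_mkcond big_seq [leRHS]big_seq.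
apply: ler_sum => i si; have := PQ i si; have := f0 i si.
by case: (P i); case: (Q i) => // _ /(_ isT).
Qed.

Lemma sum_const_seq (R : realFieldType) (I : Type) (s : seq I) (r : R) :
  \sum_(i <- s) r = (size s)%:R * r.
Proof. by rewrite big_const_seq count_predT iter_addr_0 mulr_natl. Qed.

(** * A convolution estimate from equivariant centers *)

Section CenteredTriples.
Variables (R : realType) (G : groupType) (V : choiceType) (act : G -> V -> V).
Variables (S : G -> G -> V -> Prop) (P N : nat).
Hypothesis act1 : forall m, act 1%g m = m.
Hypothesis actM : forall a b m, act (a * b)%g m = act a (act b m).
Hypothesis S_act : forall h a b m, S a b m -> S (h * a)%g (h * b)%g (act h m).
Hypothesis S_count : forall a b (ms : seq V), uniq ms ->
  (forall m, m \in ms -> S a b m) -> (size ms <= P)%N.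
Hypothesis act_count : forall a b m m' (gs : seq G), S a b m -> uniq gs ->
  (forall h, h \in gs -> act h m = m') -> (size gs <= N)%N.

(** The point [act h^-1 m] is a center for [1] and [mu], so it takes at most [P] values, each for at
    most [N] elements [h]. *)
Let translates_count m mu (gs : seq G) : uniq gs ->
  (forall h, h \in gs -> S h (h * mu)%g m) -> (size gs <= N * P)%N.
Proof.
move=> ugs gsS; pose ms := undup [seq act (h^-1)%g m | h <- gs].
have msS m' : m' \in ms -> S 1%g mu m'.
  rewrite mem_undup => /mapP[h hgs ->].
  by have := S_act (h^-1)%g (gsS _ hgs); rewrite mulgA mulVg mul1g.
have fiber m' : m' \in ms -> (size [seq h <- gs | act (h^-1)%g m == m'] <= N)%N.
  move=> m'ms; apply: (act_count (m' := m) (msS _ m'ms)); first exact: filter_uniq.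
  by move=> h; rewrite mem_filter => /andP[/eqP <- _]; rewrite -actM mulgV act1.
apply: (@leq_trans (\sum_(m' <- ms) size [seq h <- gs | act (h^-1)%g m == m'])).
  rewrite -sum1_size (eq_bigr (fun m' => \sum_(h <- gs | act (h^-1)%g m == m') 1)%N).
    rewrite (exchange_big_dep xpredT) //= big_seq [X in (_ <= X)%N]big_seq.
    apply: leq_sum => h hgs; have hm : act (h^-1)%g m \in ms.
      by rewrite mem_undup; apply/mapP; exists h.
    by rewrite sum1_count -has_count; apply/hasP; exists (act (h^-1)%g m) => /=.
  by move=> m' _; rewrite sum1_count size_filter.
apply: (@leq_trans (\sum_(m' <- ms) N)).
  by rewrite big_seq [X in (_ <= X)%N]big_seq; exact: leq_sum.
rewrite big_const_seq count_predT iter_addn_0 leq_mul2l.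
by rewrite (S_count (a := 1%g) (b := mu)) ?orbT // undup_uniq.
Qed.

Variables (m0 : V) (A F : seq G) (f g : G -> R).
Hypotheses (uA : uniq A) (uF : uniq F).
Hypothesis center : forall h k, h \in A -> exists m, [/\ S 1%g h m, S h k m & S 1%g k m].

Let B := undup [seq (h^-1 * k)%g | h <- A, k <- F].

(** The factors are [P] for the centers given [k], [P] for the centers given [h], and [N * P] for
    the [h] given a center and [h^-1 k]. *)
Lemma convolution_sum_bound :
  \sum_(k <- F) (\sum_(h <- A) f h * g (h^-1 * k)%g) ^+ 2 <=
  (N * P ^ 3)%:R * (\sum_(h <- A) f h ^+ 2) * (\sum_(u <- B) g u ^+ 2).
Proof.
have [|c cP] := @choice _ _ (fun hk m => hk.1 \in A ->
    [/\ S 1%g hk.1 m, S hk.1 hk.2 m & S 1%g hk.2 m]) .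
  move=> [h k] /=; have [hA|_] := boolP (h \in A); last first.
    by exists m0.
  by have [m] := center k hA; exists m.
pose M := undup [seq c (h, k) | h <- A, k <- F].
have cM h k : h \in A -> k \in F -> c (h, k) \in M.
  by move=> hA kF; rewrite mem_undup; apply/allpairsP; exists (h, k).
(* Replacing the chosen center [c (h, k)] by all admissible ones makes the factor with [f]
   independent of [k], so the sums separate. *)
pose phi m := \sum_(h <- A | `[< S 1%g h m >]) f h ^+ 2.
pose gam m k := \sum_(h <- A | `[< S h k m >]) g (h^-1 * k)%g ^+ 2.
have phi0 m : 0 <= phi m by apply: sumr_ge0 => h _; exact: sqr_ge0.
have gam0 m k : 0 <= gam m k by apply: sumr_ge0 => h _; exact: sqr_ge0.
have per_k k : k \in F -> (\sum_(h <- A) f h * g (h^-1 * k)%g) ^+ 2 <=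
    P%:R * \sum_(m <- M) phi m * gam m k.
  move=> kF; pose Mk := [seq m <- M | `[< S 1%g k m >]].
  pose U m := \sum_(h <- A | c (h, k) == m) f h * g (h^-1 * k)%g.
  have uMk : uniq Mk by rewrite filter_uniq // undup_uniq.
  have szMk : (size Mk <= P)%N.
    by apply: (S_count (a := 1%g) (b := k)) => // m; rewrite mem_filter => /andP[/asboolP].
  have -> : \sum_(h <- A) f h * g (h^-1 * k)%g = \sum_(m <- Mk) 1 * U m.
    rewrite /U (eq_bigr (fun m => \sum_(h <- A | c (h, k) == m) f h * g (h^-1 * k)%g)); last first.
      by move=> m _; rewrite mul1r.
    rewrite (exchange_big_dep xpredT) //= big_seq [RHS]big_seq.
    apply: eq_bigr => h hA; have [_ _ Sk] := cP (h, k) hA.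
    have ckM : c (h, k) \in Mk by rewrite mem_filter cM // andbT; exact/asboolP.
    rewrite -big_filter (eq_filter (a2 := pred1 (c (h, k)))) => [|m]; last exact: eq_sym.
    by rewrite filter_pred1_uniq // big_seq1.
  apply: le_trans (sum_cauchy_schwarz Mk xpredT (fun=> 1) U) _.
  have -> : \sum_(m <- Mk) (1 : R) ^+ 2 = (size Mk)%:R.
    by rewrite -sum1_size natr_sum; apply: eq_bigr => m _; rewrite expr1n.
  have U2 m : U m ^+ 2 <= phi m * gam m k.
    apply: le_trans (sum_cauchy_schwarz _ _ _ _) _.
    apply: ler_pM; try (by apply: sumr_ge0 => h _; exact: sqr_ge0);
      apply: sum_le_cond => h hA; rewrite ?sqr_ge0 // => /eqP <-; apply/asboolP;
      by have [] := cP (h, k) hA.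
  apply: ler_pM => //; first by apply: sumr_ge0 => m _; exact: sqr_ge0.
    by rewrite ler_nat.
  rewrite /Mk big_filter big_mkcond /=; apply: ler_sum => m _.
  by case: ifP => _; rewrite ?U2 // mulr_ge0.
have sum_gam m : \sum_(k <- F) gam m k <= (N * P)%:R * \sum_(u <- B) g u ^+ 2.
  (* With [u] in place of [h^-1 k], the sum over [k] has at most the one term [k = h * u], and
     [translates_count] bounds the number of [h]. *)
  pose T u h k : R := if `[< S h k m >] && (u == h^-1 * k)%g then g u ^+ 2 else 0.
  have -> : \sum_(k <- F) gam m k = \sum_(u <- B) \sum_(h <- A) \sum_(k <- F) T u h k.
    rewrite exchange_big /= [RHS](eq_bigr (fun h => \sum_(k <- F) \sum_(u <- B) T u h k)); last first.
      by move=> h _; exact: exchange_big.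
    rewrite [RHS]exchange_big /= [LHS]big_seq [RHS]big_seq; apply: eq_bigr => k kF.
    rewrite /gam big_mkcond /= [LHS]big_seq [RHS]big_seq; apply: eq_bigr => h hA.
    rewrite /T; case: asboolP => Sh; last by rewrite big1.
    have uB : (h^-1 * k)%g \in B by rewrite mem_undup; apply/allpairsP; exists (h, k).
    by rewrite -big_mkcond -big_filter filter_pred1_uniq ?undup_uniq // big_seq1.
  rewrite mulr_sumr; apply: ler_sum => u _.
  pose Au := [seq h <- A | `[< S h (h * u)%g m >]].
  have szAu : (size Au <= N * P)%N.
    apply: (translates_count (m := m) (mu := u)); first exact: filter_uniq.
    by move=> h; rewrite mem_filter => /andP[/asboolP].
  apply: (@le_trans _ _ (\sum_(h <- Au) g u ^+ 2)); last first.
    by rewrite sum_const_seq ler_wpM2r ?sqr_ge0 // ler_nat.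
  rewrite /Au big_filter [leRHS]big_mkcond; apply: ler_sum => h _.
  have -> : \sum_(k <- F) T u h k = \sum_(k <- F | k == (h * u)%g) T u h k.
    rewrite [RHS]big_mkcond; apply: eq_bigr => k _; rewrite /T; case: (k =P _) => // ne.
    case: (u =P _) => [E|_]; last by rewrite andbF.
    by case: ne; rewrite E mulgA mulgV mul1g.
  rewrite -big_filter; have [kF|kF] := boolP ((h * u)%g \in F).
    by rewrite filter_pred1_uniq // big_seq1 /T mulgA mulVg mul1g eqxx andbT.
  rewrite (@eq_in_filter _ _ pred0) ?filter_pred0 ?big_nil => [|k kin]; last first.
    by apply/eqP => E; move: kF; rewrite -E kin.
  by case: ifP => // _; exact: sqr_ge0.
have sum_phi : \sum_(m <- M) phi m <= P%:R * \sum_(h <- A) f h ^+ 2.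
  rewrite /phi (exchange_big_dep xpredT) //= mulr_sumr; apply: ler_sum => h _.
  rewrite -big_filter sum_const_seq ler_wpM2r ?sqr_ge0 // ler_nat; apply: (S_count (a := 1%g) (b := h)).
    by rewrite filter_uniq // undup_uniq.
  by move=> m; rewrite mem_filter => /andP[/asboolP].
have SB0 : 0 <= \sum_(u <- B) g u ^+ 2 by apply: sumr_ge0 => u _; exact: sqr_ge0.
apply: (@le_trans _ _ (\sum_(k <- F) P%:R * \sum_(m <- M) phi m * gam m k)).
  by rewrite big_seq [leRHS]big_seq; exact: ler_sum.
rewrite -mulr_sumr exchange_big /=.
apply: (@le_trans _ _ (P%:R * \sum_(m <- M) phi m * ((N * P)%:R * \sum_(u <- B) g u ^+ 2))).
  rewrite ler_wpM2l //; apply: ler_sum => m _; rewrite -mulr_sumr.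
  by rewrite ler_wpM2l.
rewrite -mulr_suml.
apply: (@le_trans _ _ (P%:R * ((P%:R * \sum_(h <- A) f h ^+ 2) * ((N * P)%:R * \sum_(u <- B) g u ^+ 2)))).
  by apply: ler_wpM2l => //; apply: ler_wpM2r sum_phi; exact: mulr_ge0.
rewrite !natrM le_eqVlt; apply/orP; left; apply/eqP; ring.
Qed.

End CenteredTriples.

(** * From finite sums to the operator norm *)

Section OperatorNorm.
Variables (R : realType) (G : groupType).
Implicit Types f g : G -> R[i].
Local Notation normc := (@ComplexField.Normc.normc R).

Lemma normc_ge0 (z : R[i]) : 0 <= normc z.
Proof. by case: z => a b; exact: sqrtr_ge0. Qed.

Lemma normc_sum (s : seq G) (a : G -> R[i]) :
  normc (\sum_(x <- s) a x) <= \sum_(x <- s) normc (a x).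
Proof.
elim: s => [|x s IH]; first by rewrite !big_nil ComplexField.Normc.normc0.
rewrite !big_cons; apply: le_trans (_ : normc (a x) + normc (\sum_(y <- s) a y) <= _).
  exact: le_normcD.
by rewrite lerD2l.
Qed.

Lemma le_l2norm f (s : seq G) : uniq s ->
  ((Num.sqrt (\sum_(x <- s) normc (f x) ^+ 2))%:E <= l2norm f)%E.
Proof.
move=> us; have -> : forall r : R, (Num.sqrt r)%:E = sqrte r%:E by [].
rewrite /l2norm lee_sqrt; last by apply: esum_ge0 => x _; rewrite lee_fin sqr_ge0.
apply: esum_ge; exists [set` s]; first by split=> //; exact: finite_seq.
by rewrite -fsbig_seq // sumEFin.
Qed.

Lemma l2norm_le f (r : R) : 0 <= r ->
  (forall s, uniq s -> \sum_(x <- s) normc (f x) ^+ 2 <= r ^+ 2) ->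
  (l2norm f <= r%:E)%E.
Proof.
move=> r0 le; have -> : r%:E = sqrte (r ^+ 2)%:E by rewrite /= sqrtr_sqr ger0_norm.
rewrite /l2norm lee_sqrt ?lee_fin ?sqr_ge0 //.
apply: ge_ereal_sup => _ [F [finF _] <-].
by rewrite fsbig_finite //= sumEFin lee_fin; apply: le; exact: fset_uniq.
Qed.

Lemma convolution_seq f g (A : seq G) k : uniq A -> (forall h, f h != 0 -> h \in A) ->
  convolution f g k = \sum_(h <- A) f h * g (h^-1 * k)%g.
Proof.
move=> uA fA; rewrite /convolution (fsbigE A) //= => [|h _ nAh].
  by apply: eq_bigl => h; rewrite in_setT.
have [fh0|/fA] := eqVneq (f h) 0; first by rewrite fh0 mul0r.
by rewrite (negbTE nAh).
Qed.

Variables (V : choiceType) (m0 : V) (act : G -> V -> V).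
Variables (S : G -> G -> V -> Prop) (P N : nat).
Hypothesis act1 : forall m, act 1%g m = m.
Hypothesis actM : forall a b m, act (a * b)%g m = act a (act b m).
Hypothesis S_act : forall h a b m, S a b m -> S (h * a)%g (h * b)%g (act h m).
Hypothesis S_count : forall a b (ms : seq V), uniq ms ->
  (forall m, m \in ms -> S a b m) -> (size ms <= P)%N.
Hypothesis act_count : forall a b m m' (gs : seq G), S a b m -> uniq gs ->
  (forall h, h \in gs -> act h m = m') -> (size gs <= N)%N.

(** Passing to moduli reduces to real functions. On a finite set of values [k] only finitely many
    values of [g] occur, and their squares sum to at most 1. *)
Lemma opnorm_le f (C : R) : finitely_supported f ->
  (forall h k, f h != 0 -> exists m, [/\ S 1%g h m, S h k m & S 1%g k m]) ->
  0 <= C -> (N * P ^ 3)%:R <= C ^+ 2 ->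
  (opnorm f <= C%:E * l2norm f)%E.
Proof.
move=> finf center C0 NP.
pose A : seq G := fset_set [set x | f x != 0].
have uA : uniq A by exact: fset_uniq.
have AP h : (h \in A) = (f h != 0).
  rewrite in_fset_set //; apply/idP/idP; rewrite inE //.
apply: ge_ereal_sup => _ [g /= g1 <-].
apply: (@le_trans _ _ (C * Num.sqrt (\sum_(h <- A) normc (f h) ^+ 2))%:E); last first.
  by rewrite EFinM lee_wpmul2l ?lee_fin // le_l2norm.
have SA0 : 0 <= \sum_(h <- A) normc (f h) ^+ 2 by apply: sumr_ge0 => h _; exact: sqr_ge0.
apply: l2norm_le => [|F uF]; first by rewrite mulr_ge0 ?sqrtr_ge0.
rewrite exprMn sqr_sqrtr //.
have cA h k : h \in A -> exists m, [/\ S 1%g h m, S h k m & S 1%g k m].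
  by rewrite AP; exact: center.
have := @convolution_sum_bound _ _ _ _ _ _ _ act1 actM S_act S_count act_count m0
  A F (normc \o f) (normc \o g) uA uF cA.
set B := undup _ => bound.
have gB : \sum_(u <- B) normc (g u) ^+ 2 <= 1.
  have := le_l2norm g (undup_uniq _ : uniq B); rewrite g1 lee_fin.
  by rewrite -[leRHS]sqrtr1 ler_sqrt.
apply: (@le_trans _ _ (\sum_(k <- F) (\sum_(h <- A) (normc \o f) h * (normc \o g) (h^-1 * k)%g) ^+ 2)).
  apply: ler_sum => k _; rewrite (@convolution_seq f g A k) //; last by move=> h; rewrite AP.
  rewrite ler_pXn2r ?nnegrE ?normc_ge0 //.
    apply: le_trans (normc_sum _ _) _; apply: ler_sum => h _.
    by rewrite /= ComplexField.Normc.normcM.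
  by apply: sumr_ge0 => h _; rewrite mulr_ge0 ?normc_ge0.
apply: le_trans bound _; rewrite -[leRHS]mulr1; apply: ler_pM => //.
- by rewrite mulr_ge0.
- by apply: sumr_ge0 => u _; exact: sqr_ge0.
- by apply: ler_wpM2r.
Qed.

End OperatorNorm.

Lemma uniq_size_card_le (T : choiceType) (A : set T) (s : seq T) N :
  A #<= `I_N -> uniq s -> (forall x, x \in s -> A x) -> (size s <= N)%N.
Proof.
move=> AN us sA; apply: leq_trans (geq_card_fset_set AN).
have finA : finite_set A by apply/finite_set_leP; exists N.
by apply: uniq_leq_size => // x /sA Ax; rewrite in_fset_set // inE.
Qed.

(** * The action on vertices and the polynomial bound *)

Section RapidDecayOfActions.
Variables (R : realType) (G : groupType) (X : metricType R).
Variables (K : cube_complex R X) (act : G -> X -> X).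
Hypothesis dist_induced : forall p q : X, induced_dist K p q = (mdist p q)%:E.
Hypothesis HX : CAT0 X.
Local Notation d := (@mdist R X).
Local Notation vertex := (is_vertex K).
Implicit Types (x y m p : X).

Lemma between_sym x y m : between K x y m -> between K y x m.
Proof. by move=> [vm xym]; split=> // H hH Hy Hx; exact: xym. Qed.

(** A halfspace separating [x] from [m] also separates [x] from [y], so a cover for [x] and [y]
    bounds [d x m]; its size is at most the squared distance. *)
Lemma between_dist x y m : vertex x -> vertex y -> between K x y m ->
  d x m <= d x y ^+ 2.
Proof.
move=> vx vy [vm xym]; have [s cs sz] := separating_cover dist_induced HX vx vy.
apply: le_trans sz; apply: (dist_le_cover dist_induced HX vx vm) => H [hH nHx Hm].
apply: cs; split=> //; apply: contrapT => nHy; have [u [v [uv HE]]] := hH.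
rewrite HE in nHx nHy Hm; apply: (halfspace_disjoint Hm).
apply: xym; [exact: halfspace_is (edge_sym uv)|..];
  exact: (halfspaceN dist_induced HX uv).
Qed.

Hypothesis act_action : is_action act.
Hypothesis act_cellular : cellular_action K act.

Lemma act_isom h p q : d (act h p) (act h q) = d p q.
Proof. by have [+ _] := act_cellular; apply. Qed.

Lemma actK h p : act h^-1%g (act h p) = p.
Proof. by have [a1 aM] := act_action; rewrite -aM mulVg a1. Qed.

Lemma actVK h p : act h (act h^-1%g p) = p.
Proof. by have [a1 aM] := act_action; rewrite -aM mulgV a1. Qed.

(** The cell [[set p]] has a one-point cell as image. Charts being isometric, a cell with a free
    coordinate has more than one point. *)
Lemma vertex_act h p : vertex p -> vertex (act h p).
Proof.
move=> [c [a [ac ap]]]; have ca := corner_cube ac.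
have cell : is_cell K [set p].
  exists c, a; split=> //; apply/seteqP; split=> [q ->|q [b [_ ab] <-]] /=.
    by exists a => //; exact: cube_suppxx.
  by have -> : b = a by apply/rowP => i; rewrite ab.
have [_ /(_ h _ cell)[c' [x [cx E]]]] := act_cellular.
have half : `|2^-1| <= 2^-1 :> R by rewrite ger0_norm ?invr_ge0.
have img b : cube_supp x b -> chart b = act h p.
  move=> xb; have : [set act h q | q in [set p]] (chart b) by rewrite E; exists b.
  by move=> [q -> <-].
exists c', x; split; last exact: img (cube_suppxx cx).
move=> i; apply: contrapT => nxi.
have xi : `|x 0 i| < 2^-1 by rewrite lt_neqAle cx andbT; exact/eqP.
have up s : `|s| <= 2^-1 -> cube_supp x (upd x i s).
  by move=> s2; apply: cube_supp_upd => //; exact: cube_suppxx.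
have half' : `|- 2^-1| <= 2^-1 :> R by rewrite normrN.
have := chart_isometry dist_induced HX (proj1 (up _ half)) (proj1 (up _ half')).
rewrite (img _ (up _ half)) (img _ (up _ half')) mdistxx ed_upd.
have -> : 2^-1 - - 2^-1 = 1 :> R by field.
by rewrite normr1 => /eqP; rewrite eq_sym oner_eq0.
Qed.

Lemma edge_act h u v : edge K u v -> edge K (act h u) (act h v).
Proof.
by move=> [vu vv uv]; split; [exact: vertex_act|exact: vertex_act|rewrite act_isom].
Qed.

Lemma halfspace_act h u v p :
  halfspace K (act h u) (act h v) (act h p) <-> halfspace K u v p.
Proof.
split=> -[vp lt]; split; rewrite ?act_isom // in lt *; last exact: vertex_act.
by rewrite -(actK h p); exact: vertex_act.
Qed.

Lemma between_act h x y m : between K x y m -> between K (act h x) (act h y) (act h m).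
Proof.
move=> [vm xym]; split; first exact: vertex_act.
move=> H [u [v [uv ->]]]; rewrite -(actVK h u) -(actVK h v) !halfspace_act.
by apply: xym; exact/halfspace_is/edge_act.
Qed.

Variables (n N : nat) (x0 : X).
Hypothesis dim_le : forall c, (dim K c <= n)%N.
Hypothesis stab : forall p, vertex p -> [set g | act g p = p] #<= `I_N.
Hypothesis vx0 : vertex x0.

(** A polynomial dominating the square root of [N * P ^ 3]: [N <= N.+1 ^ 2], and the cube of the
    second base is at most its fourth power. *)
Definition RD_bound (r : R) : R := N.+1%:R * (2 * (n%:R * r ^+ 4 + 1) ^+ n) ^+ 2.

(** An interval alone has no size bound in terms of [r], as [b] is arbitrary; closeness to an end
    provides one. *)
Definition close_center (r : R) (a b : G) m := between K (act a x0) (act b x0) m /\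
  (d (act a x0) m <= r ^+ 2 \/ d (act b x0) m <= r ^+ 2).

Lemma close_center_count r k a b (ms : seq X) : (r ^+ 2) ^+ 2 < k.+1%:R -> uniq ms ->
  (forall m, m \in ms -> close_center r a b m) ->
  (size ms <= 2 * (n * k).+1 ^ n)%N.
Proof.
move=> rk ums msP; have va := vertex_act a vx0; have vb := vertex_act b vx0.
pose near m := d (act a x0) m <= r ^+ 2.
rewrite -(count_predC near ms) -!size_filter mul2n -addnn leq_add //.
  apply: (count_between dist_induced HX dim_le va vb _ rk); first exact: filter_uniq.
  by move=> m; rewrite mem_filter => /andP[am /msP[abm _]].
apply: (count_between dist_induced HX dim_le vb va _ rk); first exact: filter_uniq.
move=> m; rewrite mem_filter => /andP[/= nam /msP[/between_sym abm [am|bm]]] //.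
by rewrite /near am in nam.
Qed.

Lemma opnorm_RD (r : R) (f : G -> R[i]) : 0 <= r -> finitely_supported f ->
  (forall h, f h != 0 -> d x0 (act h x0) <= r) ->
  (opnorm f <= (RD_bound r)%:E * l2norm f)%E.
Proof.
move=> r0 finf fr; have [a1 aM] := act_action.
pose k := Num.truncn ((r ^+ 2) ^+ 2).
have /andP[kr rk] : k%:R <= (r ^+ 2) ^+ 2 < k.+1%:R by apply/truncn_itv/sqr_ge0.
pose Q : R := 2 * (n%:R * r ^+ 4 + 1) ^+ n.
have nr0 : 0 <= n%:R * r ^+ 4 by rewrite mulr_ge0 ?exprn_ge0.
have pow1 : 1 <= (n%:R * r ^+ 4 + 1) ^+ n by rewrite exprn_ege1 // lerDr.
have Q1 : 1 <= Q by rewrite /Q; lra.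
have PQ : (2 * (n * k).+1 ^ n)%N%:R <= Q.
  rewrite natrM ler_wpM2l // natrX lerXn2r ?nnegrE ?addr_ge0 //.
  by rewrite -natr1 natrM lerD2r ler_wpM2l // (le_trans kr) // -exprM.
have vact h : vertex (act h x0) by exact: vertex_act.
have RD0 : 0 <= RD_bound r by rewrite /RD_bound mulr_ge0 // sqr_ge0.
apply: (@opnorm_le R G X x0 act (close_center r) (2 * (n * k).+1 ^ n) N) => //.
- move=> h a b m [abm am]; split; first by rewrite !aM; exact: between_act.
  by rewrite !aM !act_isom.
- by move=> a b ms; exact: close_center_count.
- move=> a b m m' [|h0 gs] [[vm _] _] // ugs gsm.
  have h0m : act h0 m = m' by apply: gsm; rewrite inE eqxx.
  (* Elements carrying [m] to [m'] differ by elements of the stabilizer of [m]. *)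
  rewrite -(size_map (fun h => (h0^-1 * h)%g)).
  apply: (uniq_size_card_le (stab vm)).
    by rewrite map_inj_uniq // => u v; exact: mulgI.
  by move=> _ /mapP[h hgs ->] /=; rewrite aM gsm // -h0m actK.
- move=> h l fh; have hr := fr h fh.
  have sq x y m : vertex x -> vertex y -> between K x y m -> d x y <= r -> d x m <= r ^+ 2.
    move=> vx vy /(between_dist vx vy) le xyr; apply: le_trans le _.
    by rewrite lerXn2r ?nnegrE ?mdist_ge0.
  (* The median lies in all three intervals. Its distances to [x0] and to [act h x0] are controlled
     by the short interval between these two, whatever [l] is. *)
  have [m vm mP] := median dist_induced HX vx0 (vact h) (vact l).
  have b1 : between K x0 (act h x0) m by split=> // H hH H1 H2; apply: mP => //; constructor 1.
  have b2 : between K (act h x0) (act l x0) m by split=> // H hH H1 H2; apply: mP => //; constructor 2.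
  have b3 : between K x0 (act l x0) m by split=> // H hH H1 H2; apply: mP => //; constructor 3.
  have xm : d x0 m <= r ^+ 2 by exact: sq b1 _.
  exists m; rewrite /close_center a1; split; split=> //; left=> //.
  by apply: (sq _ x0) => //; [exact: between_sym|rewrite metric_sym].
apply: (@le_trans _ _ (N%:R * Q ^+ 3)).
  by rewrite natrM natrX ler_wpM2l // lerXn2r ?nnegrE // (le_trans ler01).
have Q0 : 0 <= Q by exact: le_trans Q1.
have NN : N%:R <= N.+1%:R ^+ 2 :> R by rewrite -natrX ler_nat; nia.
have QQ : Q ^+ 3 <= (Q ^+ 2) ^+ 2 by rewrite -exprM ler_weXn2l.
rewrite /RD_bound -/Q (exprMn _ N.+1%:R); apply: ler_pM NN QQ => //.
by rewrite exprn_ge0.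
Qed.

Lemma length_function_act : length_function (fun g => d x0 (act g x0)).
Proof.
have [a1 aM] := act_action; split=> [h||h|h h'].
- exact: mdist_ge0.
- by rewrite a1 mdistxx.
- by rewrite -(act_isom h) actVK metric_sym.
by rewrite aM -(act_isom h x0 (act h' x0)) metric_triangle.
Qed.

Lemma property_RD_act : property_RD R G.
Proof.
exists (fun g => d x0 (act g x0)); split; first exact: length_function_act.
exists (N.+1%:R%:P * (2%:P * (n%:R%:P * 'X^4 + 1%:P) ^+ n) ^+ 2) => r f r0 finf fr.
have -> : (N.+1%:R%:P * (2%:P * (n%:R%:P * 'X^4 + 1%:P) ^+ n) ^+ 2).[r] = RD_bound r.
  rewrite hornerM hornerC horner_exp hornerM hornerC horner_exp.
  by rewrite hornerD hornerM !hornerC hornerXn.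
exact: opnorm_RD.
Qed.

End RapidDecayOfActions.

Theorem theorem0p4 (R : realType) (G : groupType) (X : metricType R)
    (K : cube_complex R X) (act : G -> X -> X) :
  CAT0_cube_complex K ->
  finite_dimensional K ->
  is_action act ->
  cellular_action K act ->
  proper_action act ->
  uniformly_bounded_stabilizers K act ->
  property_RD R G.
Proof.
move=> [[p _] dist_induced HX] [n dim_le] act_action act_cellular _ [N stab].
have [c _] := chart_surj K p.
pose a : 'rV[R]_(dim K c) := const_mx 2^-1.
have ac : corner a by move=> i; rewrite mxE ger0_norm ?invr_ge0.
exact: (property_RD_act dist_induced HX act_action act_cellular dim_le stab
  (corner_vertex ac)).
Qed.
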